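(* For every $u=\begin{pmatrix} u_1 \\ u_2 \end{pmatrix}\in \mathsf{D}(T_{\mathbb{R}^2_+})$, $$\|T_{\mathbb{R}^2_+}u\|^2=\|\partial_y u\|^2+\|\partial_x^2u\|^2+2\delta\|\partial_xu\|^2+\delta^2\|u\|^2,$$ where $\|\cdot\|$ denotes the $L^2$-norm over $\mathbb{R}^2_+$.
   Context: Let $\mathbb{R}^2_+:=\mathbb{R}\times(0,\infty)$ with coordinates $(x,y)$, and let $\delta\ge 0$ be a constant. The semi-Dirac operator $T_{\mathbb{R}^2_+}$ in $L^2(\mathbb{R}^2_+;\mathbb{C}^2)$ acts as $$T_{\mathbb{R}^2_+}:=\begin{pmatrix} -i\partial_y & -\partial_x^2+\delta \\ -\partial_x^2+\delta & i\partial_y \end{pmatrix}$$ on the domain $$\mathsf{D}(T_{\mathbb{R}^2_+})=\{u=(u_1,u_2)\in H^1(\mathbb{R}^2_+;\mathbb{C}^2):\ \partial_x^2u\in L^2(\mathbb{R}^2_+;\mathbb{C}^2),\ u_1=u_2\text{ on }y=0\},$$ where the boundary condition is understood in the sense of traces. For vector-valued $u$, $\|u\|^2=\|u_1\|^2+\|u_2\|^2$. *)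

(* Defs.v *)
From HB Require Import structures.
From mathcomp Require Import all_boot all_order all_algebra.
From mathcomp Require Import complex.
From mathcomp Require Import all_classical all_reals all_analysis.
Set Implicit Arguments.
Unset Strict Implicit.
Unset Printing Implicit Defensive.
Import Order.TTheory GRing.Theory Num.Theory.
Import numFieldNormedType.Exports.
Local Open Scope classical_set_scope.
Local Open Scope ring_scope.
Local Open Scope complex_scope.

(* Elements of L^2(D; C) are handled through Borel representatives: functions
   on the whole type, of which only the values on D matter, up to null sets. *)
Definition L2norm {d : measure_display} {T : measurableType d} {R : realType}
    (mu : {measure set T -> \bar R}) (D : set T) (f : T -> R[i]) : \bar R :=
  'N[mu]_(2%:E)[(fun x => (ComplexField.Normc.normc (f x))%:E) \_ D]%E.

Definition L2 {d : measure_display} {T : measurableType d} {R : realType}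
    (mu : {measure set T -> \bar R}) (D : set T) (f : T -> R[i]) : Prop :=
  [/\ measurable_fun D (fun x => complex.Re (f x)),
      measurable_fun D (fun x => complex.Im (f x)) &
      (L2norm mu D f < +oo)%E].

Definition cintegral {d : measure_display} {T : measurableType d}
    {R : realType} (mu : {measure set T -> \bar R}) (D : set T)
    (f : T -> R[i]) : R[i] :=
  (\int[mu]_(x in D) complex.Re (f x)) +i*
  (\int[mu]_(x in D) complex.Im (f x)).

Section SemiDirac.
Context {R : realType}.

Definition area :
    {measure set (measurableTypeR R * measurableTypeR R) -> \bar R} :=
  (@lebesgue_measure R \x @lebesgue_measure R)%E.

Definition halfplane : set (R * R) := [set z | 0 < z.2].

Definition dx (f : R * R -> R) : R * R -> R := fun z => 'D_(1, 0) f z.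
Definition dy (f : R * R -> R) : R * R -> R := fun z => 'D_(0, 1) f z.

(* Being infinitely differentiable: every iterated partial derivative, in any
   order, is (Frechet) differentiable.  The letters of the word w stand for
   d/dx (true) and d/dy (false). *)
Definition smooth (f : R * R -> R) : Prop :=
  forall (w : seq bool) (z : R * R),
    differentiable (foldr (fun b g => if b then dx g else dy g) f w) z.

Definition supp (f : R * R -> R) : set (R * R) := closure [set z | f z != 0].

(* C_c^oo(U), for an open subset U of the plane. *)
Definition test_function (U : set (R * R)) (phi : R * R -> R) : Prop :=
  [/\ smooth phi, compact (supp phi) & supp phi `<=` U].

(* v in L^2 is the distributional derivative d_x^a d_y^b u of u on the
   half-plane.  Real test functions suffice, by linearity. *)
Definition is_weak_derivative (a b : nat) (u v : R * R -> R[i]) : Prop :=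
  L2 area halfplane v /\
  forall phi : R * R -> R, test_function halfplane phi ->
    cintegral area halfplane (fun z => u z * (iter a dx (iter b dy phi) z)%:C)
    = (-1) ^+ (a + b) * cintegral area halfplane (fun z => v z * (phi z)%:C).

(* The L^2 distributional derivative when there is one (it is unique up to a
   null set, and one representative is chosen); the zero function otherwise. *)
Definition weakD (a b : nat) (u : R * R -> R[i]) : R * R -> R[i] :=
  xget (fun=> 0) [set v | is_weak_derivative a b u v].

Definition has_weakD (a b : nat) (u : R * R -> R[i]) : Prop :=
  exists v : R * R -> R[i], is_weak_derivative a b u v.

Definition H1 (u : R * R -> R[i]) : Prop :=
  [/\ L2 area halfplane u, has_weakD 1 0 u & has_weakD 0 1 u].

Definition cdx (f : R * R -> R[i]) : R * R -> R[i] := fun z =>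
  dx (fun w => complex.Re (f w)) z +i* dx (fun w => complex.Im (f w)) z.
Definition cdy (f : R * R -> R[i]) : R * R -> R[i] := fun z =>
  dy (fun w => complex.Re (f w)) z +i* dy (fun w => complex.Im (f w)) z.

Definition ctest_function (U : set (R * R)) (f : R * R -> R[i]) : Prop :=
  test_function U (fun z => complex.Re (f z)) /\
  test_function U (fun z => complex.Im (f z)).

(* g is the trace of u in H^1 on the line y = 0.  The trace operator is the
   continuous extension to H^1 of f |-> f(., 0), defined on the (dense)
   restrictions to the half-plane of functions in C_c^oo(R^2; C). *)
Definition is_trace (u : R * R -> R[i]) (g : R -> R[i]) : Prop :=
  L2 (@lebesgue_measure R) setT g /\
  exists f : nat -> R * R -> R[i],
    [/\ forall n, ctest_function setT (f n),
        (fun n => L2norm area halfplane (fun z => f n z - u z))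
          @ \oo --> 0%E,
        (fun n => L2norm area halfplane (fun z => cdx (f n) z - weakD 1 0 u z))
          @ \oo --> 0%E,
        (fun n => L2norm area halfplane (fun z => cdy (f n) z - weakD 0 1 u z))
          @ \oo --> 0%E &
        (fun n => L2norm (@lebesgue_measure R) setT
                    (fun x => f n (x, 0) - g x))
          @ \oo --> 0%E].

Definition spinor : Type := ((R * R -> R[i]) * (R * R -> R[i]))%type.

Definition sqnorm (u : spinor) : \bar R :=
  (L2norm area halfplane u.1 ^+ 2 + L2norm area halfplane u.2 ^+ 2)%E.

Definition vweakD (a b : nat) (u : spinor) : spinor :=
  (weakD a b u.1, weakD a b u.2).

Definition domT (u : spinor) : Prop :=
  [/\ H1 u.1 /\ H1 u.2,
      has_weakD 2 0 u.1 /\ has_weakD 2 0 u.2 &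
      exists g : R -> R[i], is_trace u.1 g /\ is_trace u.2 g].

Definition semiDirac (delta : R) (u : spinor) : spinor :=
  (fun z => - 'i%C * weakD 0 1 u.1 z
            + (- weakD 2 0 u.2 z + delta%:C * u.2 z),
   fun z => (- weakD 2 0 u.1 z + delta%:C * u.1 z)
            + 'i%C * weakD 0 1 u.2 z).

End SemiDirac.

Arguments spinor R : clear implicits.

(* Main.v *)
Require Import Defs.
From mathcomp Require Import all_boot all_order all_algebra.
From mathcomp Require Import complex.
From mathcomp Require Import all_classical all_reals all_analysis.
From mathcomp Require Import measurable_realfun ring lra.
Set Implicit Arguments.
Unset Strict Implicit.
Unset Printing Implicit Defensive.
Import Order.TTheory GRing.Theory Num.Theory.
Import numFieldNormedType.Exports.
Local Open Scope classical_set_scope.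
Local Open Scope ring_scope.

(** Write [T u] componentwise and expand the square: the identity reduces to
    [- Re <u_xx, u> = ||u_x||^2] and to the vanishing of the cross terms
    [Re (i <u1_y, u2> + i <u1, u2_y>)] and [Re (i <u1_y, u2_xx> + i <u1_xx, u2_y>)].

    Weak derivatives in [x] may be tested against functions that do not vanish
    near [y = 0], because a cutoff in [y] commutes with [d/dx].  The smooth
    functions approximating [u] in the definition of its trace are therefore
    admissible, and give the first identity.  They also give Green's formula
    [<u1_y, u2> + <u1, u2_y> = - <g1, g2>] in the direction [y]; with
    [g1 = g2] the first cross term vanishes.

    For the second one, [u_xy] need not be square integrable, so [u_xx] is
    replaced with a second difference quotient in [x], for which Green's formula
    has the boundary term [<g, D_h g>]; this is real since [D_h] is symmetric.
    Letting [h] tend to 0 only requires weak convergence of the difference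
    quotients, which follows from a bound by [||u_xx||] and from their
    convergence against smooth functions. *)

(** * Square-integrable functions *)

Lemma cvg_dist_le {R : realType} (u v : R ^nat) (l : R) :
  (forall n, `|u n - l| <= v n) -> v @ \oo --> 0 -> u @ \oo --> l.
Proof.
move=> uv v0; apply/cvgrPdist_le => e e0.
move/cvgrPdist_le : v0 => /(_ _ e0); apply: filterS => n.
rewrite sub0r normrN distrC => vn.
by apply: le_trans (uv n) _; apply: le_trans vn; exact: ler_norm.
Qed.

Section SquareIntegrable.
Context {d : measure_display} {T : measurableType d} {R : realType}.
Variables (mu : {measure set T -> \bar R}) (D : set T).
Hypothesis mD : measurable D.
Implicit Types f g : T -> R.

(** The analysis is done on real functions; complex ones enter through their real and imaginary
    parts. *)
Definition sqint f :=
  measurable_fun D f /\ mu.-integrable D (EFin \o (fun x => f x ^+ 2)).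

Definition ip f g : R := \int[mu]_(x in D) (f x * g x).

Definition nrm f : R := Num.sqrt (ip f f).

(** Comes from the pointwise bound |fg| <= f^2 + g^2. *)
Lemma sqint_mul f g : sqint f -> sqint g ->
  mu.-integrable D (EFin \o (fun x => f x * g x)).
Proof.
move=> [mf If] [mg Ig].
apply: (le_integrable mD _ _ (integrableD mD If Ig)).
  by apply/measurable_EFinP; exact: measurable_funM.
move=> x Dx /=; rewrite lee_fin.
rewrite [leRHS]ger0_norm ?addr_ge0 ?sqr_ge0// ler_norml.
by apply/andP; split; nra.
Qed.

Lemma sqintD f g : sqint f -> sqint g -> sqint (fun x => f x + g x).
Proof.
move=> sf sg; have [mf If] := sf; have [mg Ig] := sg; split.
  exact: measurable_funD.
have := integrableD mD (integrableD mD If (integrableZl mD 2 (sqint_mul sf sg))) Ig.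
apply: eq_integrable => // x _ /=.
by congr (_%:E); ring.
Qed.

Lemma sqintZ a f : sqint f -> sqint (fun x => a * f x).
Proof.
move=> [mf If]; split; first exact: measurable_funM.
have := integrableZl mD (a ^+ 2) If.
by apply: eq_integrable => // x _ /=; congr (_%:E); ring.
Qed.

Lemma eq_sqint f g : {in D, f =1 g} -> sqint f -> sqint g.
Proof.
move=> fg [mf If]; split; first by apply: eq_measurable_fun mf.
by apply: eq_integrable If => // x xD /=; rewrite fg.
Qed.

Lemma sqintB f g : sqint f -> sqint g -> sqint (fun x => f x - g x).
Proof.
move=> sf sg; apply: eq_sqint (sqintD sf (sqintZ (-1) sg)) => x _.
by rewrite mulN1r.
Qed.

Lemma eq_ip f g f' g' : {in D, f =1 f'} -> {in D, g =1 g'} ->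
  ip f g = ip f' g'.
Proof. by move=> ff gg; apply: eq_Rintegral => x xD; rewrite ff// gg. Qed.

Lemma ipC f g : ip f g = ip g f.
Proof. by apply: eq_Rintegral => x _; rewrite mulrC. Qed.

Lemma ipDl f g h : sqint f -> sqint g -> sqint h ->
  ip (fun x => f x + g x) h = ip f h + ip g h.
Proof.
move=> sf sg sh; rewrite /ip -RintegralD//; [|exact: sqint_mul..].
by apply: eq_Rintegral => x _; rewrite mulrDl.
Qed.

Lemma ipZl a f g : sqint f -> sqint g -> ip (fun x => a * f x) g = a * ip f g.
Proof.
move=> sf sg; rewrite /ip -RintegralZl//; last exact: sqint_mul.
by apply: eq_Rintegral => x _; rewrite mulrA.
Qed.

Lemma ipBl f g h : sqint f -> sqint g -> sqint h ->
  ip (fun x => f x - g x) h = ip f h - ip g h.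
Proof.
move=> sf sg sh; rewrite /ip -RintegralB//; [|exact: sqint_mul..].
by apply: eq_Rintegral => x _; rewrite mulrBl.
Qed.

Lemma ipDr f g h : sqint f -> sqint g -> sqint h ->
  ip h (fun x => f x + g x) = ip h f + ip h g.
Proof. by move=> sf sg sh; rewrite ipC ipDl// !(ipC h). Qed.

Lemma ipBr f g h : sqint f -> sqint g -> sqint h ->
  ip h (fun x => f x - g x) = ip h f - ip h g.
Proof. by move=> sf sg sh; rewrite ipC ipBl// !(ipC h). Qed.

Lemma ipZr a f g : sqint f -> sqint g -> ip g (fun x => a * f x) = a * ip g f.
Proof. by move=> sf sg; rewrite ipC ipZl// (ipC g). Qed.

Lemma ip_ge0 f : 0 <= ip f f.
Proof. by apply: Rintegral_ge0 => x _; rewrite -expr2 sqr_ge0. Qed.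

Lemma nrm_ge0 f : 0 <= nrm f. Proof. exact: sqrtr_ge0. Qed.

(** The quadratic polynomial t -> ||f - t g||^2 is nonnegative for every real t. *)
Lemma cauchy_schwarz f g : sqint f -> sqint g -> `|ip f g| <= nrm f * nrm g.
Proof.
move=> sf sg.
have P t : 0 <= ip f f - 2 * t * ip f g + t ^+ 2 * ip g g.
  have stg := sqintZ t sg.
  have := ip_ge0 (fun x => f x - t * g x).
  rewrite (ipBl sf stg (sqintB sf stg)) (ipZl _ sg (sqintB sf stg)).
  rewrite (ipBr sf stg sf) (ipBr sf stg sg) !ipZr// (ipC g f).
  by move=> /le_trans; apply; rewrite le_eqVlt; apply/orP; left; apply/eqP; ring.
rewrite -(@ler_pXn2r _ 2)// ?nnegrE ?mulr_ge0 ?nrm_ge0//.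
rewrite exprMn !sqr_sqrtr ?ip_ge0// real_normK ?num_real//.
have [gg0|gg0] := eqVneq (ip g g) 0.
  suff -> : ip f g = 0 by rewrite expr0n/= mulr_ge0 ?ip_ge0.
  apply/eqP; apply: contraT => fg0.
  (* The polynomial is now affine in t, and this value of t would make it equal to -1. *)
  have := P ((ip f f + 1) / (2 * ip f g)); rewrite gg0 mulr0 addr0.
  have -> : 2 * ((ip f f + 1) / (2 * ip f g)) * ip f g = ip f f + 1 by field.
  by lra.
have ggp : 0 < ip g g by rewrite lt_def gg0 ip_ge0.
(* This is the minimiser of the polynomial. *)
have := P (ip f g / ip g g).
have -> : ip f f - 2 * (ip f g / ip g g) * ip f g + (ip f g / ip g g) ^+ 2 * ip g g
  = (ip f f * ip g g - ip f g ^+ 2) / ip g g by field.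
by rewrite pmulr_lge0 ?invr_gt0// subr_ge0.
Qed.

Definition L2cvg (fn : nat -> T -> R) f :=
  [/\ forall n, sqint (fn n), sqint f &
      nrm (fun x => fn n x - f x) @[n --> \oo] --> 0].

Lemma L2cvg_cst f : sqint f -> L2cvg (fun=> f) f.
Proof.
move=> sf; split=> //.
have -> : (fun n : nat => nrm (fun x => f x - f x)) = cst 0; last exact: cvg_cst.
apply/funext => n; rewrite /nrm (_ : ip _ _ = 0) ?sqrtr0//.
rewrite /ip (@eq_Rintegral _ _ _ mu D (cst 0)) => [|x _]; last by rewrite subrr mul0r.
by rewrite Rintegral_cst// mul0r.
Qed.

(** The difference is <fn - f, gn - g> + <fn - f, g> + <f, gn - g>, and Cauchy-Schwarz bounds each
    term. *)
Lemma ip_cvg fn f gn g : L2cvg fn f -> L2cvg gn g ->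
  ip (fn n) (gn n) @[n --> \oo] --> ip f g.
Proof.
move=> [sfn sf cf] [sgn sg cg].
apply: (@cvg_dist_le _ _
  (fun n => nrm (fun x => fn n x - f x) * nrm (fun x => gn n x - g x) +
     nrm (fun x => fn n x - f x) * nrm g + nrm f * nrm (fun x => gn n x - g x))).
- move=> n; have sB := sqintB (sfn n) sf; have sB' := sqintB (sgn n) sg.
  have -> : ip (fn n) (gn n) - ip f g =
     ip (fun x => fn n x - f x) (fun x => gn n x - g x) +
     ip (fun x => fn n x - f x) g + ip f (fun x => gn n x - g x).
    by rewrite !ipBl// !ipBr//; ring.
  apply: le_trans (ler_normD _ _) _; apply: lerD; last exact: cauchy_schwarz.
  apply: le_trans (ler_normD _ _) _; apply: lerD; exact: cauchy_schwarz.
- rewrite [X in _ --> X](_ : 0 = 0 * 0 + 0 * nrm g + nrm f * 0); last by ring.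
  apply: cvgD; last by apply: cvgM => //; exact: cvg_cst.
  by apply: cvgD; apply: cvgM => //; exact: cvg_cst.
Qed.

End SquareIntegrable.

(** * Complex L^2 functions through their real and imaginary parts *)

Section ComplexL2.
Context {d : measure_display} {T : measurableType d} {R : realType}.
Variables (mu : {measure set T -> \bar R}) (D : set T).
Hypothesis mD : measurable D.
Local Open Scope complex_scope.
Implicit Types f g : T -> R[i].

(** Stated in the extended reals, so that finiteness of the norm can be turned into integrability of
    |f|^2 in [L2_sqint]. *)
Lemma L2norm_poweR f : (L2norm mu D f `^ 2 =
  \int[mu]_(x in D) (complex.Re (f x) ^+ 2 + complex.Im (f x) ^+ 2)%:E)%E.
Proof.
rewrite /L2norm poweR_Lnorm ?pnatr_eq0// [RHS]integral_mkcond.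
apply: eq_integral => x _; rewrite /patch; case: ifPn => _.
  rewrite /= powR_mulrn ?normr_ge0//.
  case: (f x) => a b /=; rewrite ger0_norm ?sqrtr_ge0//.
  by rewrite sqr_sqrtr// addr_ge0 ?sqr_ge0.
by rewrite abse0 poweR0r// ?eqe ?pnatr_eq0.
Qed.

Lemma L2_sqint f : L2 mu D f ->
  sqint mu D (fun x => complex.Re (f x)) /\
  sqint mu D (fun x => complex.Im (f x)).
Proof.
move=> [mRe mIm foo].
have If : mu.-integrable D (EFin \o
    (fun x => complex.Re (f x) ^+ 2 + complex.Im (f x) ^+ 2)).
  apply/integrableP; split.
    by apply/measurable_EFinP; apply: measurable_funD; exact: measurable_funX.
  apply: le_lt_trans (poweR_lty 2 foo); rewrite L2norm_poweR.
  rewrite le_eqVlt; apply/orP; left; apply/eqP; apply: eq_integral => x _ /=.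
  by rewrite ger0_norm// addr_ge0 ?sqr_ge0.
by split; split => //; apply: (le_integrable mD _ _ If);
  try (by apply/measurable_EFinP; exact: measurable_funX);
  move=> x _ /=; rewrite lee_fin !ger0_norm ?addr_ge0 ?sqr_ge0// ?lerDl ?lerDr sqr_ge0.
Qed.

Lemma L2normE f :
  sqint mu D (fun x => complex.Re (f x)) ->
  sqint mu D (fun x => complex.Im (f x)) ->
  L2norm mu D f = (Num.sqrt (
    ip mu D (fun x => complex.Re (f x)) (fun x => complex.Re (f x)) +
    ip mu D (fun x => complex.Im (f x)) (fun x => complex.Im (f x))))%:E.
Proof.
move=> sRe sIm.
have := L2norm_poweR f.
have -> : (\int[mu]_(x in D) (complex.Re (f x) ^+ 2 + complex.Im (f x) ^+ 2)%:E
  = (ip mu D (fun x => complex.Re (f x)) (fun x => complex.Re (f x)) +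
    ip mu D (fun x => complex.Im (f x)) (fun x => complex.Im (f x)))%:E)%E.
  rewrite /ip -RintegralD//; [|exact: sqint_mul..].
  by rewrite /Rintegral fineK//; apply: integrable_fin_num => //;
    exact: (integrableD mD (sqint_mul mD sRe sRe) (sqint_mul mD sIm sIm)).
have : (0 <= L2norm mu D f)%E by exact: Lnorm_ge0.
case: (L2norm mu D f) => [r| |]//=; last by rewrite gt_eqF// ?pnatr_eq0.
rewrite lee_fin => r0 [].
rewrite powR_mulrn// => <-.
by rewrite sqrtr_sqr ger0_norm.
Qed.

Lemma sqint_L2 f :
  sqint mu D (fun x => complex.Re (f x)) ->
  sqint mu D (fun x => complex.Im (f x)) -> L2 mu D f.
Proof.
move=> sRe sIm; rewrite /L2 L2normE// ltry; split=> //.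
  by case: sRe.
by case: sIm.
Qed.

Lemma L2norm_cvg (fn : nat -> T -> R[i]) f :
  (forall n, L2 mu D (fn n)) -> L2 mu D f ->
  L2norm mu D (fun x => fn n x - f x) @[n --> \oo] --> 0%E ->
  L2cvg mu D (fun n x => complex.Re (fn n x)) (fun x => complex.Re (f x)) /\
  L2cvg mu D (fun n x => complex.Im (fn n x)) (fun x => complex.Im (f x)).
Proof.
move=> Lfn Lf c0.
have [sRe sIm] := L2_sqint Lf.
have ReB n x : complex.Re (fn n x - f x) = complex.Re (fn n x) - complex.Re (f x).
  by case: (fn n x); case: (f x).
have ImB n x : complex.Im (fn n x - f x) = complex.Im (fn n x) - complex.Im (f x).
  by case: (fn n x); case: (f x).
have sReB n : sqint mu D (fun x => complex.Re (fn n x - f x)).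
  have [sRen _] := L2_sqint (Lfn n).
  by apply: eq_sqint (sqintB mD sRen sRe) => // x _; rewrite ReB.
have sImB n : sqint mu D (fun x => complex.Im (fn n x - f x)).
  have [_ sImn] := L2_sqint (Lfn n).
  by apply: eq_sqint (sqintB mD sImn sIm) => // x _; rewrite ImB.
have {}c0 : fine (L2norm mu D (fun x => fn n x - f x)) @[n --> \oo] --> 0.
  exact: (fine_cvg c0).
split; (split=> //; first by move=> n; have [] := L2_sqint (Lfn n)).
- apply: cvg_dist_le c0 => n.
  rewrite L2normE// subr0 ger0_norm ?nrm_ge0//= /nrm ler_sqrt.
    rewrite (@eq_ip _ _ _ mu D _ _ (fun x => complex.Re (fn n x - f x))
       (fun x => complex.Re (fn n x - f x)))//; try by move=> x _; rewrite ReB.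
    by rewrite lerDl ip_ge0.
  by rewrite addr_ge0 ?ip_ge0.
- apply: cvg_dist_le c0 => n.
  rewrite L2normE// subr0 ger0_norm ?nrm_ge0//= /nrm ler_sqrt.
    rewrite (@eq_ip _ _ _ mu D _ _ (fun x => complex.Im (fn n x - f x))
       (fun x => complex.Im (fn n x - f x)))//; try by move=> x _; rewrite ImB.
    by rewrite lerDr ip_ge0.
  by rewrite addr_ge0 ?ip_ge0.
Qed.

End ComplexL2.

(** * Smooth functions of the plane *)

Section Smooth.
Context {R : realType}.
Implicit Types (f g phi : R * R -> R) (z : R * R) (s c : R).

Let shift_dx h z : h *: (1, 0) + z = (h + z.1, z.2) :> R * R.
Proof.
case: z => x y; rewrite [LHS]surjective_pairing /= scaler0 add0r.
by rewrite [h *: 1]mulr1.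
Qed.

Let shift_dy h z : h *: (0, 1) + z = (z.1, h + z.2) :> R * R.
Proof.
case: z => x y; rewrite [LHS]surjective_pairing /= scaler0 add0r.
by rewrite [h *: 1]mulr1.
Qed.

Lemma dxE f z : dx f z = derive1 (fun t => f (t, z.2)) z.1.
Proof.
rewrite /dx /derive /derive1 -surjective_pairing.
by under eq_fun do rewrite /= shift_dx.
Qed.

Lemma dyE f z : dy f z = derive1 (fun t => f (z.1, t)) z.2.
Proof.
rewrite /dy /derive /derive1 -surjective_pairing.
by under eq_fun do rewrite /= shift_dy.
Qed.

Lemma derivable_dx f z : differentiable f z ->
  derivable (fun t => f (t, z.2)) z.1 1.
Proof.
move=> df; have : derivable f z (1, 0) by exact: diff_derivable.
rewrite /derivable.
have -> // : (fun h => h^-1 *: ((f \o shift z) (h *: (1, 0)) - f z)) =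
  (fun h => h^-1 *: (((fun t => f (t, z.2)) \o shift z.1) (h *: 1) - f (z.1, z.2))).
by apply/funext => h; rewrite /= shift_dx -surjective_pairing [h *: 1]mulr1.
Qed.

Lemma derivable_dy f z : differentiable f z ->
  derivable (fun t => f (z.1, t)) z.2 1.
Proof.
move=> df; have : derivable f z (0, 1) by exact: diff_derivable.
rewrite /derivable.
have -> // : (fun h => h^-1 *: ((f \o shift z) (h *: (0, 1)) - f z)) =
  (fun h => h^-1 *: (((fun t => f (z.1, t)) \o shift z.2) (h *: 1) - f (z.1, z.2))).
by apply/funext => h; rewrite /= shift_dy -surjective_pairing [h *: 1]mulr1.
Qed.

Lemma smooth_differentiable f z : smooth f -> differentiable f z.
Proof. by move=> /(_ [::]). Qed.

Lemma smooth_dx f : smooth f -> smooth (dx f).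
Proof. by move=> sf w z; have := sf (rcons w true) z; rewrite foldr_rcons. Qed.

Lemma smooth_dy f : smooth f -> smooth (dy f).
Proof. by move=> sf w z; have := sf (rcons w false) z; rewrite foldr_rcons. Qed.

(** Replaces the quantification over words of derivatives by a one-step check: induction on the word
    keeps every iterated derivative inside [C]. *)
Lemma smooth_coind (C : (R * R -> R) -> Prop) :
  (forall f, C f -> (forall z, differentiable f z) /\ C (dx f) /\ C (dy f)) ->
  forall f, C f -> smooth f.
Proof.
move=> HC f Cf w z.
have : C (foldr (fun b g => if b then dx g else dy g) f w).
  elim: w => //= b w /HC[_ [Cx Cy]]; by case: b.
by move=> /HC[].
Qed.

(** Translation along the boundary: it maps the half-plane and the line y = 0 to themselves, so
    difference quotients in x stay within the setting. *)
Definition tr s f : R * R -> R := fun z => f (z.1 + s, z.2).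

Lemma dx_tr s f : dx (tr s f) = tr s (dx f).
Proof.
apply/funext => z; rewrite /tr !dxE /derive1/=.
by under eq_fun do rewrite -addrA.
Qed.

Lemma dy_tr s f : dy (tr s f) = tr s (dy f).
Proof.
by apply/funext => z; rewrite /tr !dyE.
Qed.

Lemma differentiable_tr s f z :
  (forall z', differentiable f z') -> differentiable (tr s f) z.
Proof.
move=> df.
have -> : tr s f = f \o (fun w : R * R => w + (s, 0)).
  apply/funext => -[x y]; rewrite /tr /=; congr (f _).
  by rewrite [RHS]surjective_pairing /= addr0.
by apply: differentiable_comp => //; apply: differentiableD.
Qed.

(* Leibniz's rule turns iterated derivatives of a product into sums of products;
   closing under all the operations at once gives a class stable under [dx] and
   [dy], to which [smooth_coind] applies. *)
Inductive smooth_alg : (R * R -> R) -> Prop :=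
| smooth_alg_base f : smooth f -> smooth_alg f
| smooth_alg_add f g : smooth_alg f -> smooth_alg g ->
    smooth_alg (fun z => f z + g z)
| smooth_alg_mul f g : smooth_alg f -> smooth_alg g ->
    smooth_alg (fun z => f z * g z)
| smooth_alg_scale c f : smooth_alg f -> smooth_alg (fun z => c * f z)
| smooth_alg_tr s f : smooth_alg f -> smooth_alg (tr s f).

Lemma deriveD_fun f g v z : differentiable f z -> differentiable g z ->
  'D_v (fun z => f z + g z) z = 'D_v f z + 'D_v g z.
Proof. by move=> df dg; rewrite -deriveD//; exact: diff_derivable. Qed.

Lemma deriveM_fun f g v z : differentiable f z -> differentiable g z ->
  'D_v (fun z => f z * g z) z = f z * 'D_v g z + 'D_v f z * g z.
Proof.
move=> df dg; have -> : (fun z => f z * g z) = f * g by [].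
rewrite deriveM; [|exact: diff_derivable..].
by rewrite [_ *: 'D_v f z]mulrC.
Qed.

Lemma deriveZ_fun c f v z : differentiable f z ->
  'D_v (fun z => c * f z) z = c * 'D_v f z.
Proof.
move=> df; have -> : (fun z => c * f z) = c *: f by [].
by rewrite deriveZ//; exact: diff_derivable.
Qed.

Lemma smooth_alg_closed f : smooth_alg f ->
  (forall z, differentiable f z) /\ smooth_alg (dx f) /\ smooth_alg (dy f).
Proof.
elim=> {f} [f sf|f g Sf [df [Sfx Sfy]] Sg [dg [Sgx Sgy]]
           |f g Sf [df [Sfx Sfy]] Sg [dg [Sgx Sgy]]
           |c f Sf [df [Sfx Sfy]]|s f Sf [df [Sfx Sfy]]].
- split; first by move=> z; exact: smooth_differentiable.
  by split; apply: smooth_alg_base; [exact: smooth_dx|exact: smooth_dy].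
- split; first by move=> z; exact: differentiableD.
  split.
    rewrite (_ : dx _ = (fun z => dx f z + dx g z)); first exact: smooth_alg_add.
    by apply/funext => z; exact: deriveD_fun.
  rewrite (_ : dy _ = (fun z => dy f z + dy g z)); first exact: smooth_alg_add.
  by apply/funext => z; exact: deriveD_fun.
- split; first by move=> z; exact: differentiableM.
  split.
    rewrite (_ : dx _ = (fun z => f z * dx g z + dx f z * g z)).
      by apply: smooth_alg_add; exact: smooth_alg_mul.
    by apply/funext => z; exact: deriveM_fun.
  rewrite (_ : dy _ = (fun z => f z * dy g z + dy f z * g z)).
    by apply: smooth_alg_add; exact: smooth_alg_mul.
  by apply/funext => z; exact: deriveM_fun.
- split; first by move=> z; exact: differentiableZ.
  split.
    rewrite (_ : dx _ = (fun z => c * dx f z)); first exact: smooth_alg_scale.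
    by apply/funext => z; exact: deriveZ_fun.
  rewrite (_ : dy _ = (fun z => c * dy f z)); first exact: smooth_alg_scale.
  by apply/funext => z; exact: deriveZ_fun.
- split; first by move=> z; exact: differentiable_tr.
  by rewrite dx_tr dy_tr; split; exact: smooth_alg_tr.
Qed.

Lemma smooth_alg_smooth f : smooth_alg f -> smooth f.
Proof. by apply: smooth_coind; exact: smooth_alg_closed. Qed.

Lemma smoothD f g : smooth f -> smooth g -> smooth (fun z => f z + g z).
Proof.
by move=> sf sg; apply/smooth_alg_smooth/smooth_alg_add; exact: smooth_alg_base.
Qed.

Lemma smoothM f g : smooth f -> smooth g -> smooth (fun z => f z * g z).
Proof.
by move=> sf sg; apply/smooth_alg_smooth/smooth_alg_mul; exact: smooth_alg_base.
Qed.

Lemma smoothZ c f : smooth f -> smooth (fun z => c * f z).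
Proof.
by move=> sf; apply/smooth_alg_smooth/smooth_alg_scale; exact: smooth_alg_base.
Qed.

Lemma smooth_tr s f : smooth f -> smooth (tr s f).
Proof.
by move=> sf; apply/smooth_alg_smooth/smooth_alg_tr; exact: smooth_alg_base.
Qed.

End Smooth.

(** * Smooth compactly supported functions of the plane *)

Section PlaneTest.
Context {R : realType}.
Implicit Types (f g phi : R * R -> R) (z : R * R) (s c M : R).

Definition box_supp M f :=
  forall z, f z != 0 -> `|z.1| <= M /\ `|z.2| <= M.

(** This is C_c^oo(R^2), with compactness of the support expressed by a bounding square, which is
    easy to follow through derivatives, products and translations. *)
Definition plane_test f := smooth f /\ exists M, box_supp M f.

Lemma test_plane_test (U : set (R * R)) phi :
  test_function U phi -> plane_test phi.
Proof.
move=> [sphi cphi _]; split => //.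
have [M [_ HM]] := compact_bounded cphi.
(* [compact_bounded] provides a bound for each constant strictly above [M]. *)
exists (M + 1) => z fz.
have /(HM (M + 1) (ltr_pwDr ltr01 (lexx _))) : supp phi z by exact: subset_closure.
by move=> /=; rewrite prod_normE ge_max => /andP[].
Qed.

(** The margin [e] confines the support, which is a closure, to the closed set y >= e inside the
    open half-plane. *)
Lemma plane_test_halfplane phi e : plane_test phi -> 0 < e ->
  (forall z, phi z != 0 -> e <= z.2) -> test_function halfplane phi.
Proof.
move=> [sphi [M HM]] e0 He; split => //.
- have cB : compact (`[- M, M]%classic `*` `[- M, M]%classic : set (R * R)).
    by apply: compact_setX; exact: segment_compact.
  apply: (subclosed_compact _ cB); first exact: closed_closure.
  have /closure_id -> : closed (`[- M, M]%classic `*` `[- M, M]%classic : set (R * R)).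
    by apply: compact_closed => //; exact: norm_hausdorff.
  apply: closure_subset => z /= /HM[]; rewrite !ler_norml => h1 h2.
  by split; rewrite /= in_itv.
- have cE : closed [set z : R * R | e <= z.2].
    apply: (@closed_comp _ _ (fun z : R * R => z.2) [set y | e <= y]).
      by move=> z _; exact: cvg_snd.
    exact: closed_ge.
  apply: (@subset_trans _ [set z : R * R | e <= z.2]).
    by rewrite [X in _ `<=` X](closure_id _).1//; apply: closure_subset => z /= /He.
  by move=> z /= ez; exact: lt_le_trans ez.
Qed.

Lemma box_supp0 M f z : box_supp M f -> M < `|z.1| \/ M < `|z.2| -> f z = 0.
Proof.
move=> HM H; apply/eqP; apply: contraT => /HM[]; case: H => ?.
  by move=> + _; rewrite leNgt => /negP.
by move=> _; rewrite leNgt => /negP.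
Qed.

Lemma near_norm_gt M (x : R) : M < `|x| -> \forall t \near x, M < `|t|.
Proof. by have := @norm_continuous _ R x => /cvgr_gt; exact. Qed.

(** Outside the square, either |x| > M and f vanishes near x on the horizontal line, or |y| > M and
    f vanishes on the whole line. *)
Lemma box_supp_dx M f : box_supp M f -> box_supp M (dx f).
Proof.
move=> HM z; apply: contraNP => /not_andP H.
have {}H : M < `|z.1| \/ M < `|z.2| by case: H => /negP; rewrite -ltNge; [left|right].
rewrite dxE; case: H => H.
  rewrite derive1E (@near_eq_derive _ _ _ _ (cst 0)) ?derive_cst//.
  move: (near_norm_gt H); apply: filterS => t Mt.
  by apply: (box_supp0 HM); left.
rewrite (_ : (fun t => _) = cst 0) ?derive1_cst//; apply/funext => t.
by apply: (box_supp0 HM); right.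
Qed.

Lemma box_supp_dy M f : box_supp M f -> box_supp M (dy f).
Proof.
move=> HM z; apply: contraNP => /not_andP H.
have {}H : M < `|z.1| \/ M < `|z.2| by case: H => /negP; rewrite -ltNge; [left|right].
rewrite dyE; case: H => H; last first.
  rewrite derive1E (@near_eq_derive _ _ _ _ (cst 0)) ?derive_cst//.
  move: (near_norm_gt H); apply: filterS => t Mt.
  by apply: (box_supp0 HM); right.
rewrite (_ : (fun t => _) = cst 0) ?derive1_cst//; apply/funext => t.
by apply: (box_supp0 HM); left.
Qed.

Lemma box_suppW M N f : M <= N -> box_supp M f -> box_supp N f.
Proof. by move=> MN HM z /HM[h1 h2]; split; exact: le_trans MN. Qed.

Lemma plane_test_dx f : plane_test f -> plane_test (dx f).
Proof.
move=> [sf [M HM]]; split; first exact: smooth_dx.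
by exists M; exact: box_supp_dx.
Qed.

Lemma plane_test_dy f : plane_test f -> plane_test (dy f).
Proof.
move=> [sf [M HM]]; split; first exact: smooth_dy.
by exists M; exact: box_supp_dy.
Qed.

Lemma plane_testM f g : plane_test f -> smooth g ->
  plane_test (fun z => f z * g z).
Proof.
move=> [sf [M HM]] sg; split; first exact: smoothM.
by exists M => z; rewrite mulf_eq0 negb_or => /andP[/HM].
Qed.

Lemma plane_testZ c f : plane_test f -> plane_test (fun z => c * f z).
Proof.
move=> [sf [M HM]]; split; first exact: smoothZ.
by exists M => z; rewrite mulf_eq0 negb_or => /andP[_ /HM].
Qed.

Lemma plane_testD f g : plane_test f -> plane_test g ->
  plane_test (fun z => f z + g z).
Proof.
move=> [sf [M HM]] [sg [N HN]]; split; first exact: smoothD.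
exists (Num.max M N) => z; have [fz0|/HM[h1 h2] _] := eqVneq (f z) 0.
  by rewrite fz0 add0r => /HN[h1 h2]; rewrite !le_max h1 h2 !orbT.
by rewrite !le_max h1 h2.
Qed.

Lemma plane_testB f g : plane_test f -> plane_test g ->
  plane_test (fun z => f z - g z).
Proof.
move=> tf tg; have := plane_testD tf (plane_testZ (-1) tg).
by congr plane_test; apply/funext => z; rewrite mulN1r.
Qed.

Lemma box_supp_tr M s f : box_supp M f -> box_supp (M + `|s|) (tr s f).
Proof.
move=> HM z /HM[/= h1 h2]; split; last by rewrite (le_trans h2)// lerDl.
by rewrite -[X in `|X|](addrK s) (le_trans (ler_normB _ _))// lerD2r.
Qed.

Lemma plane_test_tr s f : plane_test f -> plane_test (tr s f).
Proof.
move=> [sf [M HM]]; split; first exact: smooth_tr.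
by exists (M + `|s|); exact: box_supp_tr.
Qed.

End PlaneTest.

(** * The flat function exp(-1/t) and cutoffs in y *)

Section Cutoff.
Context {R : realType}.
Implicit Types (p : {poly R}) (t x y : R).

(* The functions [t |-> p(1/t) exp(-1/t)] extended by 0 to [t <= 0] form a class
   stable under differentiation, for [p] ranging over polynomials. *)
Definition expinv p t : R := if 0 < t then p.[t^-1] * expR (- t^-1) else 0.

Lemma expr_le_expR n x : 0 < x -> x ^+ n <= n`!%:R * expR x.
Proof.
move=> x0; case: n => [|n].
  by rewrite expr0 fact0 mul1r; apply: le_trans (expR_ge1Dx x); rewrite lerDl ltW.
rewrite -ler_pdivrMl ?ltr0n ?fact_gt0// mulrC.
by apply: le_trans (expR_ge1Dxn n (ltW x0)); rewrite lerDr.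
Qed.

Lemma horner_expRN_bounded p :
  exists C, forall x, 0 < x -> `|p.[x] * expR (- x)| <= C.
Proof.
exists (\sum_(i < size p) `|p`_i| * i`!%:R) => x x0.
rewrite horner_coef mulr_suml; apply: le_trans (ler_norm_sum _ _ _) _.
apply: ler_sum => i _; rewrite -mulrA normrM ler_wpM2l//.
rewrite ger0_norm ?mulr_ge0 ?exprn_ge0 ?expR_ge0 ?(ltW x0)//.
by rewrite expRN ler_pdivrMr ?expR_gt0// expr_le_expR.
Qed.

(** The function p(x) x^2 exp(-x) is bounded for x > 0; take x = 1/t. The quadratic bound is what
    gives a zero derivative at t = 0. *)
Lemma expinv_le_sqr p : exists C, forall t, `|expinv p t| <= C * t ^+ 2.
Proof.
have [C HC] := horner_expRN_bounded (p * 'X^2); exists C => t.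
have C0 : 0 <= C by apply: le_trans (HC 1 ltr01).
rewrite /expinv; case: ifPn => t0; last by rewrite normr0 mulr_ge0 ?sqr_ge0.
have := HC t^-1; rewrite invr_gt0 => /(_ t0).
rewrite hornerM hornerXn mulrAC normrM exprVn [X in _ * X]ger0_norm ?invr_ge0 ?sqr_ge0//.
by rewrite ler_pdivrMr ?exprn_gt0.
Qed.

(** Differentiating p(1/t) exp(-1/t) yields (p(1/t) - p'(1/t)) t^-2 exp(-1/t), whence the polynomial
    X^2 (p - p'). *)
Lemma is_derive_expinv p t :
  is_derive t 1 (expinv p) (expinv ('X^2 * (p - p^`())) t).
Proof.
have [t0|t0|->] := ltgtP t 0.
- rewrite {2}/expinv ltNge (ltW t0)/=.
  apply: (@near_eq_is_derive _ _ _ (cst 0)) => //.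
  have /cvgr_lt/(_ _ t0) := @cvg_id _ (nbhs t).
  by apply: filterS => u /ltW; rewrite /expinv leNgt => /negPf ->.
  have tn0 : t != 0 by rewrite gt_eqF.
  have dV : is_derive t 1 (fun u : R => u^-1) (- t ^- 2).
    have := @is_deriveV _ id t 1 1 tn0 _.
    by rewrite /= [_ *: _]mulr1; apply.
  have dp : is_derive t 1 (fun u => p.[u^-1]) ((p^`()).[t^-1] * - t ^- 2).
    exact: (@is_derive1_comp _ (horner p) (fun u : R => u^-1)).
  have dNV : is_derive t 1 (fun u : R => - u^-1) (t ^- 2).
    by rewrite -[X in is_derive _ _ _ X]opprK; exact: is_deriveN.
  have de : is_derive t 1 (fun u => expR (- u^-1)) (expR (- t^-1) * t ^- 2).
    exact: (@is_derive1_comp _ expR (fun u : R => - u^-1)).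
  have -> : expinv ('X^2 * (p - p^`())) t = p.[t^-1] *: (expR (- t^-1) * t ^- 2) +
      expR (- t^-1) *: ((p^`()).[t^-1] * - t ^- 2).
    rewrite /expinv t0 hornerM hornerXn hornerD hornerN exprVn.
    by rewrite /GRing.scale/=; ring.
  apply: near_eq_is_derive (is_deriveM dp de).
  have /cvgr_gt/(_ _ t0) := @cvg_id _ (nbhs t).
  by apply: filterS => u; rewrite /expinv => ->.
(* At t = 0 the difference quotient is at most C |h|. Dividing by [C + 1] below covers the case C =
   0. *)
- have [C HC] := expinv_le_sqr p.
  have H0 q : expinv q 0 = 0 by rewrite /expinv ltxx.
  have H : h^-1 *: ((expinv p \o shift 0) (h *: 1) - expinv p 0) @[h --> 0^'] --> (0 : R).
    apply/cvgrPdist_le => e e0.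
    have C0 : 0 <= C by have := HC 1; rewrite expr1n mulr1; exact: le_trans.
    have eC : 0 < e / (C + 1) by rewrite divr_gt0// ltr_wpDl.
    near=> h.
    have hn0 : h != 0 by near: h; exact: nbhs_dnbhs_neq.
    have he : `|h| <= e / (C + 1).
      by near: h; exact: dnbhs0_le.
    rewrite sub0r normrN /= addr0 [h *: 1]mulr1 H0 subr0 normrM normfV.
    rewrite ler_pdivrMl ?normr_gt0//; apply: le_trans (HC h) _.
    rewrite -real_normK ?num_real// expr2 mulrCA ler_wpM2l//.
    rewrite ler_pdivlMr ?ltr_wpDl// in he.
    by apply: le_trans he; rewrite mulrC ler_wpM2l// lerDl.
  rewrite H0; apply: DeriveDef; first by apply/cvg_ex; exists 0.
  exact: (cvg_lim _ H).
Unshelve. all: by end_near. Qed.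

Lemma expinv_itv01 t : 0 <= expinv 1 t <= 1.
Proof.
rewrite /expinv; case: ifPn => t0; last by rewrite lexx ler01.
by rewrite hornerE mul1r expR_ge0/= -expR0 ler_expR oppr_le0 invr_ge0 ltW.
Qed.

(* For [p = 1], vanishes when [y <= 1/k] and increases to 1 on the half-plane as
   [k] tends to infinity; no plateau is needed. *)
Definition ycut p (k : R) : R * R -> R := fun z => expinv p (k * z.2 - 1).

(** The zero function is written as a member of the family, which is thus stable under both
    derivatives as [smooth_coind] requires. *)
Lemma dx_ycut p k : dx (ycut p k) = ycut 0 k.
Proof.
apply/funext => z; rewrite dxE /ycut/= derive1_cst /expinv horner0 mul0r.
by rewrite if_same.
Qed.

Let is_derive_ycut p k y : is_derive y 1 (fun t => expinv p (k * t - 1))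
  (expinv (k *: ('X^2 * (p - p^`()))) (k * y - 1)).
Proof.
have d1 : is_derive y 1 (fun t => k * t - 1) k.
  have -> : (fun t => k * t - 1) = (k *: id) \- cst 1 by [].
  by apply: is_derive_eq; rewrite [_ *: 1]mulr1 subr0.
have := @is_derive1_comp _ (expinv p) (fun t => k * t - 1) y _ _
  (is_derive_expinv p (k * y - 1)) d1.
move/is_derive_eq; apply.
by rewrite /expinv; case: ifP => _; rewrite ?mul0r// (hornerZ k); ring.
Qed.

Lemma dy_ycut p k : dy (ycut p k) = ycut (k *: ('X^2 * (p - p^`()))) k.
Proof.
apply/funext => z; rewrite dyE derive1E /ycut/=.
by have [_] := is_derive_ycut p k z.2.
Qed.

Lemma smooth_ycut p k : smooth (ycut p k).
Proof.
apply: (@smooth_coind _ (fun h => exists q, h = ycut q k)); last by exists p.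
move=> _ [q ->]; split.
  move=> z; apply: (@differentiable_comp _ _ _ _ snd (fun t => expinv q (k * t - 1))).
    exact: (@linear_differentiable _ _ _ snd z (fun w => @cvg_snd _ _ _ _ _)).
  by apply/derivable1_diffP; have [] := is_derive_ycut q k z.2.
by rewrite dx_ycut dy_ycut; split; eexists.
Qed.

Lemma ycut_cvg1 (y : R) : 0 < y ->
  expinv 1 (n%:R * y - 1) @[n --> \oo] --> (1 : R).
Proof.
move=> y0.
have H : n%:R * y - 1 @[n --> \oo] --> +oo%R.
  apply/cvgryPge => A.
  near=> n; rewrite lerBrDr -ler_pdivrMr//.
  by near: n; exact: nbhs_infty_ger.
have H' : expR (- (n%:R * y - 1)^-1) @[n --> \oo] --> (1 : R).
  rewrite -[X in _ --> X]expR0.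
  apply: continuous_cvg; first exact: continuous_expR.
  rewrite -oppr0; apply: cvgN; apply: ((gtr0_cvgV0 _).2 H).
  by move/cvgryPgt : H => /(_ 0).
apply: cvg_trans H'; apply: near_eq_cvg; near=> n.
rewrite /expinv (_ : 0 < _) ?hornerE ?mul1r//.
rewrite subr_gt0 -ltr_pdivrMr// div1r.
by near: n; exact: nbhs_infty_gtr.
Unshelve. all: by end_near. Qed.

End Cutoff.

(** * Integration on the half-plane *)

Section InvariantMap.
Context {d : measure_display} {T : measurableType d} {R : realType}.
Variables (mu : {measure set T -> \bar R}) (phi : T -> T) (D : set T).
Hypothesis mphi : measurable_fun setT phi.
Hypothesis mu_phi : forall A, measurable A -> mu (phi @^-1` A) = mu A.
Hypothesis mD : measurable D.
Hypothesis D_phi : phi @^-1` D = D.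
Implicit Types f g : T -> R.

(** The pushforward of [mu] by [phi] coincides with [mu] on measurable sets. *)
Lemma ge0_integral_inv (f : T -> \bar R) : measurable_fun D f ->
  (forall x, 0 <= f x)%E ->
  (\int[mu]_(x in D) f (phi x) = \int[mu]_(x in D) f x)%E.
Proof.
move=> mf f0; rewrite -[in LHS]D_phi -(ge0_integral_pushforward mphi)//.
by apply: eq_measure_integral => A mA _; exact: mu_phi.
Qed.

Lemma Rintegral_inv f : measurable_fun D f ->
  \int[mu]_(x in D) f (phi x) = \int[mu]_(x in D) f x.
Proof.
move=> mf; have mEf : measurable_fun D (EFin \o f) by exact/measurable_EFinP.
rewrite /Rintegral [in RHS]integralE [in LHS]integralE; congr (fine (_ - _)%E).
  rewrite -(ge0_integral_inv (measurable_funepos mEf) (funepos_ge0 _)).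
  by apply: eq_integral => x _; rewrite !funeposE.
rewrite -(ge0_integral_inv (measurable_funeneg mEf) (funeneg_ge0 _)).
by apply: eq_integral => x _; rewrite !funenegE.
Qed.

Lemma measurable_fun_inv f : measurable_fun D f ->
  measurable_fun D (fun x => f (phi x)).
Proof.
move=> mf; apply: (measurable_comp mD _ mf); last exact: measurable_funS mphi.
by move=> _ [x Dx <-]; rewrite -D_phi in Dx.
Qed.

Lemma sqint_inv f : sqint mu D f -> sqint mu D (fun x => f (phi x)).
Proof.
move=> [mf /integrableP[mf2 If]]; split; first exact: measurable_fun_inv.
apply/integrableP; split.
  by apply/measurable_EFinP/measurable_funX; exact: measurable_fun_inv.
apply: le_lt_trans If.
by rewrite -(@ge0_integral_inv (fun x => `|(EFin \o (fun x => (f x ^+ 2)%R)) x|%E))//;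
  exact: measurableT_comp.
Qed.

Lemma ip_inv f g : sqint mu D f -> sqint mu D g ->
  ip mu D (fun x => f (phi x)) (fun x => g (phi x)) = ip mu D f g.
Proof.
move=> [mf _] [mg _].
by rewrite /ip (@Rintegral_inv (fun x => f x * g x))//; exact: measurable_funM.
Qed.

Lemma L2cvg_inv fn f : L2cvg mu D fn f ->
  L2cvg mu D (fun n x => fn n (phi x)) (fun x => f (phi x)).
Proof.
move=> [sfn sf cf]; split; [by move=> n; exact: sqint_inv|exact: sqint_inv|].
apply: cvg_trans cf; apply: near_eq_cvg; apply: nearW => n; rewrite /nrm.
by rewrite (@ip_inv (fun x => fn n x - f x) (fun x => fn n x - f x))//; exact: sqintB.
Qed.

End InvariantMap.

(** * Translation invariance of the Lebesgue measure on the line *)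

Section LineTranslation.
Context {R : realType}.
Let leb := @lebesgue_measure R.

Definition shiftx (s : R) : measurableTypeR R -> measurableTypeR R :=
  fun x => x + s.

Lemma measurable_shiftx s : measurable_fun setT (shiftx s).
Proof. exact: measurable_funD. Qed.

Lemma lebesgue_measure_shiftx s (A : set (measurableTypeR R)) :
  measurable A -> leb (shiftx s @^-1` A) = leb A.
Proof.
move=> mA; rewrite -[LHS]/(pushforward leb (shiftx s) A).
have mf := measurable_shiftx s.
apply/esym/lebesgue_measure_unique => //= _ [[a b]] _ <-.
rewrite /pushforward.
have -> : shiftx s @^-1` `]a, b] = `]a - s, b - s]%classic.
  by apply/funext => x; rewrite /shiftx/= !in_itv/= ltrBlDr lerBrDr.
by rewrite !lebesgue_measure_itv/= !lte_fin ltrD2r -!EFinB opprB addrA subrK.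
Qed.

End LineTranslation.

(** * Measurability in the plane and translations in x *)

Section Plane.
Context {R : realType}.
Local Notation plane := (measurableTypeR R * measurableTypeR R)%type.
Let leb := @lebesgue_measure R.
Implicit Types f g : R * R -> R.

(** [plane] carries the product sigma-algebra; an open set is the union of the countably many
    rational rectangles that it contains. *)
Lemma open_measurable2 (U : set (R * R)) :
  open U -> measurable (U : set plane).
Proof.
move=> oU.
pose rect (q : (rat * rat) * (rat * rat)) : set plane :=
  `]ratr q.1.1, ratr q.1.2[%classic `*` `]ratr q.2.1, ratr q.2.2[%classic.
have -> : U = \bigcup_q (if `[< rect q `<=` U >] then rect q else set0).
  apply/seteqP; split => [z Uz|z [q _]]; last first.
    by case: asboolP => // H /H.
  move: oU; rewrite openE => /(_ _ Uz) /nbhs_ballP[e /= e0 He].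
  have [a ha] := @rat_in_itvoo _ (z.1 - e) z.1 (ltac:(by rewrite ltrBlDr ltrDl)).
  have [b hb] := @rat_in_itvoo _ z.1 (z.1 + e) (ltac:(by rewrite ltrDl)).
  have [c hc] := @rat_in_itvoo _ (z.2 - e) z.2 (ltac:(by rewrite ltrBlDr ltrDl)).
  have [d hd] := @rat_in_itvoo _ z.2 (z.2 + e) (ltac:(by rewrite ltrDl)).
  move: ha hb hc hd; rewrite !in_itv/=.
  move=> /andP[a1 a2] /andP[b1 b2] /andP[c1 c2] /andP[d1 d2].
  exists ((a, b), (c, d)) => //; case: asboolP => [_|[]].
    by rewrite /rect /= !in_itv/= a2 b1 c2 d1.
  move=> w; rewrite /rect /= !in_itv/= => -[/andP[w1 w2] /andP[w3 w4]].
  apply: He; split; rewrite /ball/= ltr_distl.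
    by apply/andP; split; lra.
  by apply/andP; split; lra.
apply: countable_bigcupT_measurable; first exact: countableP.
by move=> q; case: asboolP => // _; apply: measurableX; exact: measurable_itv.
Qed.

Lemma continuous_measurable2 f : continuous f ->
  measurable_fun setT (f : plane -> R).
Proof.
move=> cf; apply: (measurability _ (RGenOInfty.measurableE R)) => //.
move=> /= _ [_ [x ->] <-]; rewrite setTI.
by apply: open_measurable2; apply: open_comp => // z _; exact: cf.
Qed.

Lemma measurable_halfplane : measurable (halfplane : set plane).
Proof.
apply: open_measurable2.
rewrite /halfplane; apply: (@open_comp _ _ (fun z : R * R => z.2) [set y | 0 < y]).
  by move=> z _; exact: cvg_snd.
exact: open_gt.
Qed.

Definition shift2 (s : R) : plane -> plane := fun z => (z.1 + s, z.2).

Lemma measurable_shift2 s : measurable_fun setT (shift2 s).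
Proof.
apply: measurable_fun_pair => //.
exact: measurable_funD.
Qed.

(** By uniqueness of the product measure it suffices to treat rectangles, of which only the first
    side moves. *)
Lemma area_shift2 s (A : set plane) : measurable A ->
  area (shift2 s @^-1` A) = area A.
Proof.
move=> mA; have mphi := measurable_shift2 s.
rewrite -[LHS]/(pushforward area (shift2 s) A).
apply/esym/product_measure_unique => //= B C mB mC.
rewrite /pushforward.
have -> : shift2 s @^-1` (B `*` C) = (shiftx s @^-1` B) `*` C by [].
have mB' : measurable (shiftx s @^-1` B).
  by rewrite -[X in measurable X]setTI; exact: measurable_shiftx.
rewrite /area product_measure1E//; congr (_ * _)%E; exact: lebesgue_measure_shiftx.
Qed.

Lemma halfplane_shift2 s : shift2 s @^-1` halfplane = halfplane.
Proof. by []. Qed.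

End Plane.

Lemma bounded_supp_integrable {d : measure_display} {T : measurableType d}
    {R : realType} (mu : {measure set T -> \bar R}) (D B : set T) (f : T -> R)
    (C : R) :
  measurable D -> measurable B -> (mu B < +oo)%E -> measurable_fun D f ->
  (forall x, `|f x| <= C) -> (forall x, ~ B x -> f x = 0) ->
  mu.-integrable D (EFin \o f).
Proof.
move=> mD mB muB mf fC f0.
have mDB : measurable (D `&` B) by exact: measurableI.
have : mu.-integrable (D `&` B) (EFin \o f).
  apply: measurable_bounded_integrable => //.
  - by apply: le_lt_trans muB; apply: le_measure; rewrite ?inE.
  - by apply: measurable_funS mf => // x [].
  - exists C; split; first exact: num_real.
    by move=> M CM x _ /=; apply: le_trans (fC x) (ltW CM).
move=> /(integrable_mkcond _ mDB) H; apply/(integrable_mkcond _ mD).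
apply: eq_integrable H => // x _; rewrite /patch in_setI.
have [xD|//] := boolP (x \in D); have [//|xB] := boolP (x \in B).
by rewrite /= f0// => /mem_set; rewrite (negPf xB).
Qed.

(** * Integrals of smooth compactly supported functions *)

Section PlaneIntegrals.
Context {R : realType}.
Local Notation plane := (measurableTypeR R * measurableTypeR R)%type.
Local Notation leb := (@lebesgue_measure R).
Implicit Types (f g : R * R -> R) (M C : R) (D : set plane).

Lemma smooth_continuous f : smooth f -> continuous f.
Proof.
by move=> sf z; apply: differentiable_continuous; exact: smooth_differentiable.
Qed.

Definition box M : set plane := `[- M, M]%classic `*` `[- M, M]%classic.

Lemma measurable_box M : measurable (box M).
Proof. by apply: measurableX; exact: measurable_itv. Qed.

Lemma area_box M : (area (box M) < +oo)%E.
Proof.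
rewrite /area/= product_measure1E//= !lebesgue_measure_itv/=.
by case: ifP => _; rewrite ?mul0e// -EFinM ltry.
Qed.

Lemma lebesgue_segment M : (leb `[(- M)%R, M]%classic < +oo)%E.
Proof.
by rewrite lebesgue_measure_itv/=; case: ifP => _; rewrite ?ltry// -EFinB ltry.
Qed.

Lemma box_suppP M f z : box_supp M f -> ~ box M z -> f z = 0.
Proof.
move=> HM nB; apply/eqP; apply: contra_notT nB => /HM[].
by rewrite !ler_norml => h1 h2; split; rewrite /= in_itv.
Qed.

Lemma plane_test_bounded f : plane_test f ->
  exists C, 0 <= C /\ forall z, `|f z| <= C.
Proof.
move=> [sf [M HM]].
have cB : compact (`[- M, M]%classic `*` `[- M, M]%classic : set (R * R)).
  by apply: compact_setX; exact: segment_compact.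
have : compact (f @` (`[- M, M]%classic `*` `[- M, M]%classic : set (R * R))).
  by apply: continuous_compact => //; apply: continuous_subspaceT; exact: smooth_continuous.
move=> /compact_bounded[C [_ HC]].
exists (Num.max 0 (C + 1)); split; first by rewrite le_max lexx.
move=> z; have [->|fz] := eqVneq (f z) 0; first by rewrite normr0 le_max lexx.
rewrite le_max; apply/orP; right; apply: (HC _ (ltr_pwDr ltr01 (lexx _))).
exists z => //; apply: contrapT => nB; move/eqP : fz; apply.
exact: (box_suppP HM).
Qed.

Lemma plane_test_measurable D f : plane_test f -> measurable_fun D f.
Proof.
move=> [sf _]; apply: measurable_funTS.
by apply: continuous_measurable2; exact: smooth_continuous.
Qed.

Lemma plane_test_integrable D f : measurable D -> plane_test f ->
  area.-integrable D (EFin \o f).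
Proof.
move=> mD tf; have [C [_ HC]] := plane_test_bounded tf.
have mf := plane_test_measurable (D := D) tf.
have [_ [M HM]] := tf.
apply: (bounded_supp_integrable mD (measurable_box M) (area_box M) mf HC).
by move=> z nB; exact: (box_suppP HM).
Qed.

Lemma plane_test_sqint D f : measurable D -> plane_test f -> sqint area D f.
Proof.
move=> mD tf; split; first exact: plane_test_measurable.
have -> : (fun z => f z ^+ 2) = (fun z => f z * f z) by [].
by apply: plane_test_integrable => //; apply: plane_testM => //; case: tf.
Qed.

Lemma smooth_continuous_dx f y : smooth f -> continuous (fun x => f (x, y)).
Proof.
move=> sf x; apply: differentiable_continuous; apply/derivable1_diffP.
exact: (@derivable_dx _ _ (x, y) (smooth_differentiable _ sf)).
Qed.

Lemma smooth_continuous_dy f x : smooth f -> continuous (fun y => f (x, y)).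
Proof.
move=> sf y; apply: differentiable_continuous; apply/derivable1_diffP.
exact: (@derivable_dy _ _ (x, y) (smooth_differentiable _ sf)).
Qed.

Lemma plane_test_sqint_line f : plane_test f ->
  sqint leb setT (fun x => f (x, 0)).
Proof.
move=> tf; have [C [C0 HC]] := plane_test_bounded tf.
have [sf [M HM]] := tf.
have mf : measurable_fun [set: measurableTypeR R] (fun x => f (x, 0)).
  by apply: continuous_measurable_fun; exact: smooth_continuous_dx.
split => //.
have mI : measurable (`[- M, M]%classic : set (measurableTypeR R)).
  exact: measurable_itv.
apply: (@bounded_supp_integrable _ _ _ _ _ _ _ (C ^+ 2) measurableT mI).
- exact: lebesgue_segment.
- exact: measurable_funX.
- by move=> x; rewrite normrX ler_pXn2r ?nnegrE.
- move=> x nI; rewrite (_ : f (x, 0) = 0) ?expr0n//.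
  apply/eqP; apply: contra_notT nI => /HM[/=].
  by rewrite ler_norml in_itv.
Qed.

(** Fubini with y as the inner variable, then the fundamental theorem of calculus on each vertical
    half-line. *)
Lemma FTC_halfplane f : plane_test f ->
  \int[area]_(z in halfplane) dy f z = - \int[leb]_x f (x, 0).
Proof.
move=> tf; have mH := @measurable_halfplane R.
have tdf := plane_test_dy tf.
have [sf [M0 HM0]] := tf.
(* Positive and strictly beyond the square that contains the support, so that [f (x, M) = 0]. *)
pose M := Num.max 0 M0 + 1.
have M_gt0 : 0 < M by rewrite /M ltr_wpDl// le_max lexx.
have MM0 : M0 < M by rewrite /M ltr_pwDr// le_max lexx orbT.
have HM := box_suppW (ltW MM0) HM0.
have int_f x : (\int[leb]_(y in `]0%R, M]) (dy f (x, y))%:E = (- f (x, 0))%:E)%E.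
  have cdf : continuous (fun y => dy f (x, y)).
    by apply: smooth_continuous_dy; exact: smooth_dy.
  rewrite integral_itv_obnd_cbnd; last first.
    apply/measurable_EFinP; apply: measurable_funTS.
    exact: continuous_measurable_fun.
  rewrite (@continuous_FTC2 _ _ (fun y => f (x, y)))//.
  - have -> : f (x, M) = 0.
      by apply: (box_supp0 HM0); right; rewrite /= gtr0_norm.
    by rewrite sub0e EFinN.
  - exact: continuous_subspaceT.
  - have cf := @smooth_continuous_dy f x sf.
    split.
      move=> y _.
      exact: (@derivable_dy _ _ (x, y) (smooth_differentiable _ sf)).
      by apply: cvg_at_right_filter; exact: cf.
    by apply: cvg_at_left_filter; exact: cf.
  - by move=> y _; rewrite (dyE f (x, y)).
rewrite Rintegral_mkcond.
(* Fubini is applied on the whole plane, to the extension by 0. *)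
have If : area.-integrable setT (EFin \o (dy f \_ halfplane)).
  have := (plane_test_integrable mH tdf).
  by move=> /(integrable_mkcond _ mH); rewrite restrict_EFin.
rewrite /Rintegral -(integral12_prod_meas1 If).
(* The derivative vanishes above height [M], so the half-line may be cut there. *)
have IfE x : fubini_F leb (EFin \o (dy f \_ halfplane)) x = (- f (x, 0))%:E.
  rewrite -int_f /fubini_F [RHS]integral_mkcond; apply: eq_integral => y _.
  rewrite /= /patch.
  have -> : ((x, y) \in halfplane) = (0 < y) by apply/idP/idP; rewrite inE.
  have -> : (y \in `]0, M]%classic) = (0 < y <= M) by rewrite mem_setE in_itv.
  have [y0|//] := ltP 0 y; have [//|My] := leP y M.
  rewrite (box_supp0 (box_supp_dy HM))//.
  by right; rewrite /= gtr0_norm// (lt_trans M_gt0).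
transitivity (fine (\int[leb]_x (- f (x, 0))%:E)%E).
  by congr fine; apply: eq_integral => x _; exact: IfE.
rewrite -[LHS]/(\int[leb]_x (- f (x, 0))) -mulN1r.
under eq_Rintegral do rewrite -mulN1r.
have [mf0 _] := plane_test_sqint_line tf.
have : leb.-integrable setT (EFin \o (fun x => f (x, 0))).
  have [C [_ HC]] := plane_test_bounded tf.
  have mI : measurable (`[- M, M]%classic : set (measurableTypeR R)).
    exact: measurable_itv.
  apply: (@bounded_supp_integrable _ _ _ _ _ _ _ C measurableT mI) => //.
  - exact: lebesgue_segment.
  - move=> x nI; apply/eqP; apply: contra_notT nI => /HM[/=].
    by rewrite ler_norml in_itv.
by move=> If0; rewrite RintegralZl.
Qed.

End PlaneIntegrals.

(** * Weak derivatives in the direction x *)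

Section WeakDerivativeX.
Context {R : realType}.
Local Notation plane := (measurableTypeR R * measurableTypeR R)%type.
Local Notation H := (@halfplane R).
Local Notation ipH := (ip (@area R) H).
Local Notation sqintH := (sqint (@area R) H).
Implicit Types (f g phi : R * R -> R) (v w : plane -> R).

Let mH := @measurable_halfplane R.

Lemma dx_ycutM f (p : {poly R}) k : smooth f ->
  dx (fun z => f z * ycut p k z) = (fun z => dx f z * ycut p k z).
Proof.
move=> sf; apply/funext => z; rewrite /dx deriveM_fun; last 2 first.
- exact: smooth_differentiable.
- exact/smooth_differentiable/smooth_ycut.
rewrite -/(dx (ycut p k) z) dx_ycut /ycut [expinv 0 _]/expinv horner0 mul0r.
by rewrite if_same mulr0 add0r.
Qed.

Lemma plane_test_iter_dx a phi : plane_test phi -> plane_test (iter a dx phi).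
Proof. by move=> tphi; elim: a => //= a; exact: plane_test_dx. Qed.

Lemma iter_dx_ycutM a f (p : {poly R}) k : smooth f ->
  iter a dx (fun z => f z * ycut p k z) = (fun z => iter a dx f z * ycut p k z).
Proof.
move=> sf; suff: iter a dx (fun z => f z * ycut p k z) =
    (fun z => iter a dx f z * ycut p k z) /\ smooth (iter a dx f) by case.
elim: a => //= a [-> sa]; split; last exact: smooth_dx.
exact: dx_ycutM.
Qed.

(** Dominated convergence with majorant |v phi|: the cutoff takes values in [0, 1] and tends to 1
    wherever y > 0. *)
Lemma ip_ycut_cvg v phi : sqintH v -> plane_test phi ->
  ipH v (fun z => phi z * ycut 1 n.+1%:R z) @[n --> \oo] --> ipH v phi.
Proof.
move=> sv tphi.
have sphi : sqintH phi by exact: plane_test_sqint.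
have syc n : sqintH (fun z => phi z * ycut 1 n.+1%:R z).
  apply: plane_test_sqint => //; apply: plane_testM => //; exact: smooth_ycut.
have If := sqint_mul mH sv sphi.
have [] := @dominated_convergence _ _ _ (@area R) H mH
  (fun n z => (v z * (phi z * ycut 1 n.+1%:R z))%:E)
  (fun z => (v z * phi z)%:E) (fun z => `|(v z * phi z)%:E|%E).
- move=> n; apply/measurable_EFinP.
  by apply: measurable_funM; [case: sv|case: (syc n)].
- by case/integrableP : If.
- apply: aeW => z Hz; apply/cvg_EFin; first exact: nearW.
  rewrite /comp/=; apply: cvgM; first exact: cvg_cst.
  rewrite -[X in _ --> X]mulr1; apply: cvgM; first exact: cvg_cst.
  by have := ycut_cvg1 Hz; rewrite -(cvg_shiftS (fun n => expinv 1 (n%:R * z.2 - 1))).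
- exact: integrable_norm If.
- apply: aeW => z n Hz; rewrite /= lee_fin mulrA normrM.
  have /andP[y0 y1] := expinv_itv01 (n.+1%:R * z.2 - 1).
  by rewrite ler_piMr// /ycut ger0_norm.
move=> _ _ Hc; apply: fine_cvg.
move: Hc; rewrite [X in _ --> X -> _](_ : _ = (ipH v phi)%:E)//.
by rewrite /ip /Rintegral fineK//; exact: integrable_fin_num.
Qed.

(* [phi] need not vanish near the boundary [y = 0]. *)
Lemma weak_plane_test a v w : sqintH v -> sqintH w ->
  (forall phi, test_function H phi ->
    ipH v (iter a dx phi) = (-1) ^+ a * ipH w phi) ->
  forall phi, plane_test phi ->
    ipH v (iter a dx phi) = (-1) ^+ a * ipH w phi.
Proof.
move=> sv sw Hvw phi tphi.
have sphi : smooth phi by case: tphi.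
have c1 := ip_ycut_cvg sv (plane_test_iter_dx a tphi).
have c2 := cvgM (@cvg_cst _ ((-1) ^+ a : R) _ \oo _) (ip_ycut_cvg sw tphi).
suff c3 : ipH v (fun z => iter a dx phi z * ycut 1 n.+1%:R z) @[n --> \oo] -->
    (-1) ^+ a * ipH w phi by exact: (cvg_unique _ c1 c3).
have E n : ipH v (fun z => iter a dx phi z * ycut 1 n.+1%:R z) =
    (-1) ^+ a * ipH w (fun z => phi z * ycut 1 n.+1%:R z); last first.
  by rewrite (funext E); exact: c2.
rewrite -Hvw ?iter_dx_ycutM//.
(* The cutoff of scale [n.+1] vanishes for y <= 1/(n+1), which supplies the margin. *)
apply: (@plane_test_halfplane _ _ n.+1%:R^-1) => //.
  by apply: plane_testM => //; exact: smooth_ycut.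
move=> z; rewrite mulf_eq0 negb_or => /andP[_].
rewrite /ycut /expinv; case: ifPn; rewrite ?eqxx// subr_gt0 => /ltW + _.
by rewrite -ler_pdivrMl// mulr1.
Qed.

(** Provides the majorant for differentiation under the integral in [is_derive_ip_tr]. *)
Lemma sqint_box M C : sqintH (fun z => C * \1_(box M) z).
Proof.
have mind : measurable_fun H (fun z : plane => C * \1_(box M) z).
  by apply: measurable_funM => //; apply: measurable_indic; exact: measurable_box.
split => //.
apply: (@bounded_supp_integrable _ _ _ _ _ (box M) _ (C ^+ 2)) => //.
- exact: measurable_box.
- exact: area_box.
- exact: measurable_funX.
- move=> z; rewrite ger0_norm ?sqr_ge0// indicE.
  by case: (_ \in _); rewrite ?mulr1// mulr0 expr0n/= sqr_ge0.
- by move=> z nB; rewrite indicE memNset// mulr0 expr0n.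
Qed.

(** Differentiation under the integral sign; the derivative in the shift falls on [phi] alone, so
    [v] may be merely square integrable. *)
Lemma is_derive_ip_tr phi v (s : R) : plane_test phi -> sqintH v ->
  is_derive s 1 (fun s : R => ipH (tr s phi) v) (ipH (tr s (dx phi)) v).
Proof.
move=> tphi sv.
have tdx := plane_test_dx tphi.
have [C [C0 HC]] := plane_test_bounded tdx.
have [sphi [M HM]] := tphi.
have df (x : R) z : is_derive x 1 (fun x : R => tr x phi z * v z) (tr x (dx phi) z * v z).
  have H1 : is_derive x 1 (fun x : R => tr x phi z) (tr x (dx phi) z).
    (* The shift and the abscissa play symmetric roles, so differentiating in the shift is applying
       d/dx. *)
    have -> : (fun x => tr x phi z) = (fun x => tr z.1 phi (x, z.2)).
      by apply/funext => y; rewrite /tr/= addrC.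
    apply: DeriveDef.
      apply: (@derivable_dx _ _ (x, z.2)).
      by apply: differentiable_tr => z'; exact: smooth_differentiable.
    rewrite -derive1E -[LHS](dxE (tr z.1 phi) (x, z.2)) dx_tr /tr/=.
    by rewrite addrC.
  have -> : (fun x => tr x phi z * v z) = (v z) *: (fun x => tr x phi z).
    by apply/funext => y; rewrite mulrC.
  by rewrite mulrC; exact: is_deriveZ.
have sI : s \in `]s - 1, s + 1[ by rewrite in_itv/= ltrBlDr ltrDl ltr01.
(* For shifts within 1 of [s], the translates of [dx phi] are bounded by [C] and vanish outside the
   square of half-side [M + |s| + 1]. *)
have := @cvg_differentiation_under_integral R _ plane (@area R)
  (fun x z => tr x phi z * v z) H mH s (s - 1) (s + 1) sI _ _
  (fun z => C * \1_(box (M + `|s| + 1)) z * `|v z|).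
have -> : (fun y : plane => partial1of2 (fun x z => tr x phi z * v z) s y) =
    (fun z => tr s (dx phi) z * v z).
  by apply/funext => z; rewrite partial1of2E; have [_] := df s z.
move=> Hd.
have {}Hd : h^-1 *: (ipH (tr (h + s) phi) v - ipH (tr s phi) v) @[h --> 0^'] -->
    ipH (tr s (dx phi)) v.
  apply: Hd.
  - move=> x _; apply: sqint_mul => //; apply: plane_test_sqint => //.
    exact: plane_test_tr.
  - by move=> x z _ _; have [] := df x z.
  - move=> z; rewrite !mulr_ge0// indicE; by case: (_ \in _).
  - have snv : sqintH (fun z => `|v z|).
      have [mv Iv] := sv; split; first exact: measurableT_comp.
      by apply: eq_integrable Iv => // z _; rewrite /= real_normK ?num_real.
    exact: sqint_mul (sqint_box _ _) snv.
  - move=> x z; rewrite /= in_itv/= => xI _; rewrite partial1of2E.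
    have [_ ->] := df x z; rewrite normrM ler_wpM2r//.
    have [->|nz] := eqVneq (tr x (dx phi) z) 0.
      by rewrite normr0 mulr_ge0// indicE; case: (_ \in _).
    rewrite indicE mem_set ?mulr1; first exact: HC.
    have [h1 h2] := box_supp_dx HM nz.
    have xs : `|x| <= `|s| + 1.
      rewrite -[x](subrK s) (le_trans (ler_normD _ _))// addrC lerD2l.
      by rewrite ler_distl; case/andP : xI => /ltW -> /ltW ->.
    have {}h1 : `|z.1| <= M + `|s| + 1.
      rewrite -[z.1](addrK x) (le_trans (ler_normB _ _))// -addrA.
      exact: lerD.
    have {}h2 : `|z.2| <= M + `|s| + 1.
      by rewrite (le_trans h2)// -addrA lerDl addr_ge0.
    by move: h1 h2; rewrite !ler_norml => h1 h2; split; rewrite /= in_itv.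
have E : (fun h => h^-1 *: (((fun s => ipH (tr s phi) v) \o shift s) (h *: 1) -
    ipH (tr s phi) v)) = (fun h => h^-1 *: (ipH (tr (h + s) phi) v - ipH (tr s phi) v)).
  by apply/funext => h; rewrite /= [h *: 1]mulr1.
apply: DeriveDef.
  by rewrite /derivable E; apply/cvg_ex; eexists; exact: Hd.
by rewrite /derive E; exact: cvg_lim Hd.
Qed.

End WeakDerivativeX.

(** * Second differences and the cross terms *)

(** Two uses of the mean value theorem: for [Q] on [0, h], giving a point xi, then for [P] on
    [-xi, xi], since Q'(xi) = P(xi) - P(-xi). The factor 2 is the length 2 xi <= 2 h. *)
Lemma second_difference_dist {R : realType} (q q1 q2 : R -> R) (c K h : R) :
  0 < h ->
  (forall s : R, is_derive s 1 q (q1 s)) ->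
  (forall s : R, is_derive s 1 q1 (q2 s)) ->
  (forall s, `|s| <= h -> `|q2 s - c| <= K) ->
  `|q h + q (- h) - 2 * q 0 - c * h ^+ 2| <= 2 * K * h ^+ 2.
Proof.
move=> h0 dq dq1 qc.
have dN (f f1 : R -> R) : (forall s : R, is_derive s 1 f (f1 s)) ->
    forall s : R, is_derive s 1 (fun t => f (- t)) (- f1 (- s)).
  move=> df s.
  have d1 : is_derive s 1 (fun t : R => - t) (-1) by exact: is_deriveN.
  have := @is_derive1_comp _ f (fun t => - t) s _ _ (df (- s)) d1.
  by rewrite mulrN1.
have dZ (k s : R) : is_derive s 1 (fun t : R => k * t) k.
  have -> : (fun t : R => k * t) = k *: id by [].
  by apply: is_derive_eq; rewrite [_ *: 1]mulr1.
pose Q t := q t + q (- t) - c * t ^+ 2.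
have dQ (t : R) : is_derive t 1 Q (q1 t - q1 (- t) - 2 * c * t).
  have dsq : is_derive t 1 (fun t : R => c * t ^+ 2) (2 * c * t).
    have -> : (fun t : R => c * t ^+ 2) = (fun t => c * t) * id.
      by apply/funext => y; rewrite fctE expr2 mulrA.
    have := @is_deriveM _ _ (fun t => c * t) id t 1 _ _ (dZ c t) (is_derive_id _ _).
    move=> /is_derive_eq; apply.
    by rewrite /GRing.scale/=; ring.
  exact: (is_deriveB (is_deriveD (dq t) (dN _ _ dq t)) dsq).
have contd (f f1 : R -> R) (a b : R) : (forall s : R, is_derive s 1 f (f1 s)) ->
    {within `[a, b], continuous f}.
  move=> df; apply: continuous_subspaceT => x.
  apply: differentiable_continuous; apply/derivable1_diffP.
  by have [] := df x.
have [xi xiI Exi] := MVT h0 (fun t _ => dQ t) (contd _ _ _ _ dQ).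
move: xiI; rewrite in_itv/= => /andP[xi0 xih].
pose P t := q1 t - c * t.
have dP (t : R) : is_derive t 1 P (q2 t - c) by exact: (is_deriveB (dq1 t) (dZ c t)).
have Nxi : - xi < xi by rewrite -subr_gt0 opprK addr_gt0.
have [eta etaI Eeta] := MVT Nxi (fun t _ => dP t) (contd _ _ _ _ dP).
move: etaI; rewrite in_itv/= => /andP[eta1 eta2].
have -> : q h + q (- h) - 2 * q 0 - c * h ^+ 2 = (q2 eta - c) * (2 * xi) * h.
  have -> : (q2 eta - c) * (2 * xi) = q1 xi - q1 (- xi) - 2 * c * xi.
    have -> : 2 * xi = xi - - xi by ring.
    by rewrite -Eeta /P; ring.
  have := Exi; rewrite subr0 => <-.
  by rewrite /Q oppr0 expr0n/=; ring.
have xin : `|eta| <= h.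
  by rewrite ler_norml; apply/andP; split; lra.
rewrite !normrM (gtr0_norm h0) (gtr0_norm xi0) normr_nat.
have K0 : 0 <= K by exact: le_trans (qc _ xin).
apply: (@le_trans _ _ (K * (2 * h) * h)); last first.
  by rewrite le_eqVlt; apply/orP; left; apply/eqP; ring.
rewrite (ler_wpM2r (ltW h0))//; apply: ler_pM => //.
- by rewrite mulr_ge0// ltW.
- exact: qc.
by rewrite ler_wpM2l// ltW.
Qed.

Section SecondDifference.
Context {R : realType}.
Local Notation plane := (measurableTypeR R * measurableTypeR R)%type.
Local Notation H := (@halfplane R).
Local Notation ipH := (ip (@area R) H).
Local Notation nrmH := (nrm (@area R) H).
Local Notation sqintH := (sqint (@area R) H).
Local Notation L2cvgH := (L2cvg (@area R) H).
Implicit Types (phi : R * R -> R) (f g v w : plane -> R).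

Let mH := @measurable_halfplane R.

Lemma sqint_tr (s : R) f : sqintH f -> sqintH (tr s f).
Proof.
exact: (sqint_inv (measurable_shift2 s) (@area_shift2 _ s) mH (halfplane_shift2 s)).
Qed.

Lemma ip_tr (s : R) f g : sqintH f -> sqintH g ->
  ipH (tr s f) (tr s g) = ipH f g.
Proof.
exact: (ip_inv (measurable_shift2 s) (@area_shift2 _ s) mH (halfplane_shift2 s)).
Qed.

Lemma L2cvg_tr (s : R) fn f : L2cvgH fn f ->
  L2cvgH (fun n => tr s (fn n)) (tr s f).
Proof.
exact: (L2cvg_inv (measurable_shift2 s) (@area_shift2 _ s) mH (halfplane_shift2 s)).
Qed.

Lemma nrm_tr (s : R) f : sqintH f -> nrmH (tr s f) = nrmH f.
Proof. by move=> sf; rewrite /nrm ip_tr. Qed.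

(** The pairing of [v] with the unnormalised second difference of [g] in x; divided by h^2, it
    stands in for the pairing of [g] with the second x-derivative of [v]. *)
Definition diff2 g v (h : R) : R :=
  ipH (tr h g) v + ipH (tr (- h) g) v - 2 * ipH g v.

Lemma diff2B f g v h : sqintH f -> sqintH g -> sqintH v ->
  diff2 (fun z => f z - g z) v h = diff2 f v h - diff2 g v h.
Proof.
move=> sf sg sv; rewrite /diff2 (ipBl mH sf sg sv).
rewrite -![tr _ (fun z => f z - g z)]/(fun z => tr _ f z - tr _ g z).
by rewrite !(ipBl mH)//; try exact: sqint_tr; ring.
Qed.

Lemma diff2_cvg fn f v h : L2cvgH fn f -> sqintH v ->
  diff2 (fn n) v h @[n --> \oo] --> diff2 f v h.
Proof.
move=> cf sv; have cv := L2cvg_cst mH sv.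
have c1 := ip_cvg mH (L2cvg_tr h cf) cv.
have c2 := ip_cvg mH (L2cvg_tr (- h) cf) cv.
have c3 := ip_cvg mH cf cv.
by apply: cvgB; [exact: cvgD|apply: cvgM => //; exact: cvg_cst].
Qed.

Lemma tr0 f : tr 0 f = f.
Proof. by apply/funext => -[x y]; rewrite /tr/= addr0. Qed.

Variables (v w : plane -> R).
Hypotheses (sv : sqintH v) (sw : sqintH w).
Hypothesis vw : forall phi, plane_test phi -> ipH v (dx (dx phi)) = ipH w phi.

(** The function s -> <tr s phi, v> is twice differentiable, and [vw] turns its second derivative
    into <w, tr s phi>. *)
Lemma diff2_test_dist phi (c K h : R) : plane_test phi -> 0 < h ->
  (forall s, `|s| <= h -> `|ipH w (tr s phi) - c| <= K) ->
  `|diff2 phi v h - c * h ^+ 2| <= 2 * K * h ^+ 2.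
Proof.
move=> tphi h0 wK.
have d1 s := is_derive_ip_tr s tphi sv.
have d2 s := is_derive_ip_tr s (plane_test_dx tphi) sv.
have := second_difference_dist h0 d1 d2; rewrite tr0; apply => s sh.
by rewrite ipC -!dx_tr vw ?wK//; exact: plane_test_tr.
Qed.

(** The case c = 0, with Cauchy-Schwarz and the translation invariance of the norm. *)
Lemma diff2_test_le phi (h : R) : plane_test phi -> 0 < h ->
  `|diff2 phi v h| <= 2 * (nrmH w * nrmH phi) * h ^+ 2.
Proof.
move=> tphi h0; have sphi : sqintH phi by exact: plane_test_sqint.
have := @diff2_test_dist phi 0 (nrmH w * nrmH phi) h tphi h0.
rewrite mul0r subr0; apply => s _; rewrite subr0 -(nrm_tr s sphi).
by apply: cauchy_schwarz => //; exact: sqint_tr.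
Qed.

Lemma nrm_cvg fn f : L2cvgH fn f -> nrmH (fn n) @[n --> \oo] --> nrmH f.
Proof.
move=> cf; apply: (@continuous_cvg _ _ _ _ _ _ (@Num.sqrt R) _ _ (ip_cvg mH cf cf)).
exact: sqrt_continuous.
Qed.

Variables (phin : nat -> R * R -> R) (g : plane -> R).
Hypothesis tphin : forall n, plane_test (phin n).
Hypothesis phing : L2cvgH phin g.

(** For fixed h, both sides are continuous in [g] for L^2 convergence, so the bound extends from
    test functions to their limits. *)
Lemma diff2_le (h : R) : 0 < h ->
  `|diff2 g v h| <= 2 * (nrmH w * nrmH g) * h ^+ 2.
Proof.
move=> h0.
have c1 : `|diff2 (phin n) v h| @[n --> \oo] --> `|diff2 g v h|.
  by apply: cvg_norm; exact: diff2_cvg.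
have c2 : 2 * (nrmH w * nrmH (phin n)) * h ^+ 2 @[n --> \oo] -->
    2 * (nrmH w * nrmH g) * h ^+ 2.
  apply: cvgM; last exact: cvg_cst.
  apply: cvgM; first exact: cvg_cst.
  by apply: cvgM; [exact: cvg_cst|exact: nrm_cvg].
have := ler_cvg_to c1 c2; apply; apply: nearW => n.
exact: diff2_test_le.
Qed.

End SecondDifference.

Lemma L2cvgBr {d : measure_display} {T : measurableType d} {R : realType}
    (mu : {measure set T -> \bar R}) (D : set T) (fn : nat -> T -> R)
    (f g : T -> R) : measurable D -> L2cvg mu D fn f -> sqint mu D g ->
  L2cvg mu D (fun n x => fn n x - g x) (fun x => f x - g x).
Proof.
move=> mD [sfn sf cf] sg; split; [by move=> n; exact: sqintB|exact: sqintB|].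
apply: cvg_trans cf; apply: near_eq_cvg; apply: nearW => n; rewrite /nrm.
by congr Num.sqrt; apply: eq_ip => x _; ring.
Qed.

(** * Limits of second differences and Green's formula in y *)

Section SecondDifferenceLimit.
Context {R : realType}.
Local Notation plane := (measurableTypeR R * measurableTypeR R)%type.
Local Notation H := (@halfplane R).
Local Notation ipH := (ip (@area R) H).
Local Notation nrmH := (nrm (@area R) H).
Local Notation sqintH := (sqint (@area R) H).
Local Notation L2cvgH := (L2cvg (@area R) H).
Local Notation leb := (@lebesgue_measure R).

Let mH := @measurable_halfplane R.

(* An arbitrary [g] is split into a smooth function, for which the limit is the
   second derivative at 0 of a smooth function of the shift, and a remainder of
   small norm, controlled by [diff2_le] uniformly in the shift. *)
Lemma diff2_lim (v w : plane -> R) (phin : nat -> R * R -> R) (g : plane -> R) :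
  sqintH v -> sqintH w ->
  (forall phi, plane_test phi -> ipH v (dx (dx phi)) = ipH w phi) ->
  (forall n, plane_test (phin n)) -> L2cvgH phin g ->
  k.+1%:R ^+ 2 * diff2 g v k.+1%:R^-1 @[k --> \oo] --> ipH g w.
Proof.
move=> sv sw vw tphi cphi; have [_ sg cg] := cphi.
apply/cvgrPdist_le => e e0.
(* With remainder norm [dl], [diff2_le] costs 2 ||w|| dl and replacing <phi, w> by <g, w> costs
   ||w|| dl: at most e/2 together. The smooth part costs 2 (e/4), the other half. *)
have W0 : 0 < 3 * nrmH w + 1 by rewrite ltr_wpDl// mulr_ge0// nrm_ge0.
have e1 : 0 < e / 2 / (3 * nrmH w + 1) by rewrite !divr_gt0.
move/cvgrPdist_le : cg => /(_ _ e1)[N _ /(_ N (leqnn N))] /=.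
rewrite sub0r normrN ger0_norm ?nrm_ge0// => Hd.
set phi := phin N in Hd; set dl := nrmH _ in Hd.
have tp : plane_test phi by exact: tphi.
have sp : sqintH phi by exact: plane_test_sqint.
have dlE : nrmH (fun z => g z - phi z) = dl.
  by rewrite /dl /nrm; congr Num.sqrt; apply: eq_Rintegral => x _; ring.
have cont : {for 0, continuous (fun s => ipH (tr s phi) w)}.
  apply: differentiable_continuous; apply/derivable1_diffP.
  by have [] := is_derive_ip_tr 0 tp sw.
have e4 : 0 < e / 4 by rewrite divr_gt0.
move/cvgrPdist_le : cont => /(_ _ e4) /nbhs_ballP[r /= r0 Hr].
near=> k.
have hk0 : 0 < k.+1%:R^-1 :> R by rewrite invr_gt0.
have hkr : k.+1%:R^-1 < r.
  by near: k; exact: near_infty_natSinv_lt (PosNum r0).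
set h := k.+1%:R^-1 in hk0 hkr *.
have kh : k.+1%:R ^+ 2 = h ^- 2 by rewrite /h exprVn invrK.
have h20 : 0 < h ^- 2 by rewrite invr_gt0 exprn_gt0.
have hh : h ^- 2 * h ^+ 2 = 1 by rewrite mulVf// expf_neq0// gt_eqF.
(* The remainder is itself a limit of test functions, namely of [phin m - phi]. *)
have B1 := @diff2_le _ v w sv sw vw (fun m z => phin m z - phi z) (fun z => g z - phi z)
  (fun m => plane_testB (tphi m) tp) (L2cvgBr mH cphi sp) h hk0.
rewrite dlE (diff2B _ sg sp sv) in B1.
have B2 : `|diff2 phi v h - ipH phi w * h ^+ 2| <= 2 * (e / 4) * h ^+ 2.
  apply: (@diff2_test_dist _ v w sv vw) => // s sh.
  have := Hr s; rewrite tr0 /ball/= sub0r normrN => /(_ (le_lt_trans sh hkr)).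
  by rewrite distrC (ipC _ _ w).
have B3 := cauchy_schwarz mH (sqintB mH sp sg) sw.
rewrite -/dl (ipBl mH sp sg sw) in B3.
rewrite kh -(mul1r (ipH g w)) -hh.
have -> : h ^- 2 * h ^+ 2 * ipH g w - h ^- 2 * diff2 g v h =
   h ^- 2 * - ((diff2 g v h - diff2 phi v h) + (diff2 phi v h - ipH phi w * h ^+ 2)
     + (ipH phi w - ipH g w) * h ^+ 2) by ring.
rewrite normrM normrN (gtr0_norm h20) mulrC ler_pdivrMr ?exprn_gt0//.
apply: le_trans (ler_normD _ _) _.
have nw := nrm_ge0 (@area R) H w.
have B4 : `|(ipH phi w - ipH g w) * h ^+ 2| <= (dl * nrmH w) * h ^+ 2.
  by rewrite normrM (ger0_norm (sqr_ge0 h)) ler_wpM2r// sqr_ge0.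
have B5 := le_trans (ler_normD _ _) (lerD B1 B2).
apply: le_trans (lerD B5 B4) _.
rewrite -!mulrDl ler_wpM2r ?sqr_ge0//.
rewrite ler_pdivlMr// in Hd.
have dl0 : 0 <= dl by exact: nrm_ge0.
by nra.
Unshelve. all: by end_near. Qed.

(* [p] stands for the derivative of [v] in [y] and [a] for its trace. *)
Definition trace_approx (v p : plane -> R) (a : R -> R) :=
  exists an : nat -> R * R -> R, [/\ forall n, plane_test (an n), L2cvgH an v,
    L2cvgH (fun n => dy (an n)) p &
    L2cvg leb setT (fun n x => an n (x, 0)) a].

Lemma L2cvg_shift (s : R) (an : nat -> R -> R) (a : R -> R) :
  L2cvg leb setT an a ->
  L2cvg leb setT (fun n x => an n (x + s)) (fun x => a (x + s)).
Proof.
exact: (L2cvg_inv (measurable_shiftx s) (@lebesgue_measure_shiftx _ s) measurableT).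
Qed.

(** [FTC_halfplane] for the product of [tr h f] and [g], with Leibniz's rule; translation invariance
    moves the shift from [dy g] to [f]. *)
Lemma green_test (f g : R * R -> R) (h : R) : plane_test f -> plane_test g ->
  ipH (tr h (dy f)) g + ipH (tr (- h) (dy g)) f =
  - ip leb setT (fun x => f (x + h, 0)) (fun x => g (x, 0)).
Proof.
move=> tf tg; have ttf := plane_test_tr h tf.
have [sf _] := ttf; have [sg _] := tg.
have S k := @plane_test_sqint R H k mH.
have -> : ipH (tr (- h) (dy g)) f = ipH (tr h f) (dy g).
  rewrite -[RHS](ip_tr (- h))//; [|exact: S|exact/S/plane_test_dy].
  rewrite ipC; congr (ip _ _ _ _).
  by apply/funext => -[x y]; rewrite /tr/= addrNK.
have := FTC_halfplane (plane_testM ttf sg).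
rewrite -[RHS]/(- ip leb setT (fun x => f (x + h, 0)) (fun x => g (x, 0))) => <-.
rewrite addrC /ip -RintegralD//; last 2 first.
- exact: (sqint_mul mH (S _ ttf) (S _ (plane_test_dy tg))).
- exact: (sqint_mul mH (S _ (plane_test_tr h (plane_test_dy tf))) (S _ tg)).
apply: eq_Rintegral => z _.
by rewrite [RHS]deriveM_fun -?/(dy _ _) ?dy_tr//; exact: smooth_differentiable.
Qed.

Lemma green_shift (v1 p1 v2 p2 : plane -> R) (a b : R -> R) (h : R) :
  trace_approx v1 p1 a -> trace_approx v2 p2 b ->
  ipH (tr h p1) v2 + ipH (tr (- h) p2) v1 =
  - ip leb setT (fun x => a (x + h)) b.
Proof.
move=> [an [ta cav cap cal]] [bn [tb cbv cbp cbl]].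
have c1 : ipH (tr h (dy (an n))) (bn n) + ipH (tr (- h) (dy (bn n))) (an n)
    @[n --> \oo] --> ipH (tr h p1) v2 + ipH (tr (- h) p2) v1.
  apply: cvgD; first exact: (ip_cvg mH (L2cvg_tr h cap) cbv).
  exact: (ip_cvg mH (L2cvg_tr (- h) cbp) cav).
suff c2 : ipH (tr h (dy (an n))) (bn n) + ipH (tr (- h) (dy (bn n))) (an n)
    @[n --> \oo] --> - ip leb setT (fun x => a (x + h)) b.
  exact: (cvg_unique _ c1 c2).
rewrite (funext (fun n => green_test h (ta n) (tb n))).
apply: cvgN; exact: (ip_cvg measurableT (L2cvg_shift h cal) cbl).
Qed.

Lemma green (v1 p1 v2 p2 : plane -> R) (a b : R -> R) :
  trace_approx v1 p1 a -> trace_approx v2 p2 b ->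
  ipH p1 v2 + ipH p2 v1 = - ip leb setT a b.
Proof.
move=> A B; have := green_shift 0 A B; rewrite oppr0 !tr0 => ->.
by congr (- ip _ _ _ _); apply/funext => x; rewrite addr0.
Qed.

(** Both sides equal minus the same boundary pairing. The use is Im u1, Re u2 on the left and Re u1,
    Im u2 on the right, where equal traces of u1 and u2 make the boundary terms agree. *)
Lemma cross_term_order0 (v1 p1 v2 p2 v1' p1' v2' p2' : plane -> R)
    (a b : R -> R) :
  trace_approx v1 p1 a -> trace_approx v2 p2 b ->
  trace_approx v1' p1' b -> trace_approx v2' p2' a ->
  ipH p1 v2 + ipH p2 v1 = ipH p1' v2' + ipH p2' v1'.
Proof. by move=> A B A' B'; rewrite (green A B) (green A' B') ipC. Qed.

(** Provides the approximation by test functions that [diff2_lim] requires of the y-derivative. *)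
Lemma trace_approx_dy (v p : plane -> R) (a : R -> R) : trace_approx v p a ->
  exists an, (forall n, plane_test (an n)) /\ L2cvgH an p.
Proof.
move=> [an [ta _ cap _]]; exists (fun n => dy (an n)); split => // n.
exact: plane_test_dy.
Qed.

(** Shifted Green's formula for the pair in both orders, which together contain the shifts h and -h
    of each y-derivative, minus twice the unshifted one. *)
Lemma diff2_green (v1 p1 v2 p2 : plane -> R) (a b : R -> R) (h : R) :
  trace_approx v1 p1 a -> trace_approx v2 p2 b ->
  diff2 p1 v2 h + diff2 p2 v1 h = - (
    ip leb setT (fun x => a (x + h)) b + ip leb setT (fun x => b (x + h)) a
    - 2 * ip leb setT a b).
Proof.
move=> A B; move: (green_shift h A B) (green_shift h B A) (green A B).
by rewrite /diff2; lra.
Qed.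

(* The boundary term of [diff2_green] is symmetric in [a] and [b], so the second
   differences agree before passing to the limit. *)
Lemma cross_term_order2 (v1 p1 w1 v2 p2 w2 v1' p1' w1' v2' p2' w2' : plane -> R)
    (a b : R -> R) :
  sqintH v1 -> sqintH v2 -> sqintH w1 -> sqintH w2 ->
  sqintH v1' -> sqintH v2' -> sqintH w1' -> sqintH w2' ->
  (forall phi, plane_test phi -> ipH v1 (dx (dx phi)) = ipH w1 phi) ->
  (forall phi, plane_test phi -> ipH v2 (dx (dx phi)) = ipH w2 phi) ->
  (forall phi, plane_test phi -> ipH v1' (dx (dx phi)) = ipH w1' phi) ->
  (forall phi, plane_test phi -> ipH v2' (dx (dx phi)) = ipH w2' phi) ->
  trace_approx v1 p1 a -> trace_approx v2 p2 b ->
  trace_approx v1' p1' b -> trace_approx v2' p2' a ->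
  ipH p1 w2 + ipH p2 w1 = ipH p1' w2' + ipH p2' w1'.
Proof.
move=> s1 s2 t1 t2 s1' s2' t1' t2' e1 e2 e1' e2' A1 A2 A1' A2'.
have L (v w g : plane -> R) x y : sqintH v -> sqintH w ->
    (forall phi, plane_test phi -> ipH v (dx (dx phi)) = ipH w phi) ->
    trace_approx x g y ->
    k.+1%:R ^+ 2 * diff2 g v k.+1%:R^-1 @[k --> \oo] --> ipH g w.
  by move=> sv sw vw /trace_approx_dy[an [ta ca]]; exact: diff2_lim vw ta ca.
have c : k.+1%:R ^+ 2 * diff2 p1 v2 k.+1%:R^-1 +
    k.+1%:R ^+ 2 * diff2 p2 v1 k.+1%:R^-1 @[k --> \oo] -->
    ipH p1 w2 + ipH p2 w1.
  by apply: cvgD; [exact: L s2 t2 e2 A1|exact: L s1 t1 e1 A2].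
have c' : k.+1%:R ^+ 2 * diff2 p1' v2' k.+1%:R^-1 +
    k.+1%:R ^+ 2 * diff2 p2' v1' k.+1%:R^-1 @[k --> \oo] -->
    ipH p1' w2' + ipH p2' w1'.
  by apply: cvgD; [exact: L s2' t2' e2' A1'|exact: L s1' t1' e1' A2'].
suff E k : k.+1%:R ^+ 2 * diff2 p1 v2 k.+1%:R^-1 +
           k.+1%:R ^+ 2 * diff2 p2 v1 k.+1%:R^-1 =
           k.+1%:R ^+ 2 * diff2 p1' v2' k.+1%:R^-1 +
           k.+1%:R ^+ 2 * diff2 p2' v1' k.+1%:R^-1.
  suff c2 : k.+1%:R ^+ 2 * diff2 p1 v2 k.+1%:R^-1 +
      k.+1%:R ^+ 2 * diff2 p2 v1 k.+1%:R^-1 @[k --> \oo] -->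
      ipH p1' w2' + ipH p2' w1' by exact: (cvg_unique _ c c2).
  by rewrite (funext E); exact: c'.
rewrite -!mulrDr (diff2_green _ A1 A2) (diff2_green _ A1' A2').
by rewrite [X in _ = _ * - (_ - 2 * X)]ipC; congr (_ * - (_ - _)); rewrite addrC.
Qed.

End SecondDifferenceLimit.

(** * The domain of the operator *)

Section DomainFacts.
Context {R : realType}.
Local Notation plane := (measurableTypeR R * measurableTypeR R)%type.
Local Notation H := (@halfplane R).
Local Notation ipH := (ip (@area R) H).
Local Notation sqintH := (sqint (@area R) H).
Local Notation L2cvgH := (L2cvg (@area R) H).
Local Notation leb := (@lebesgue_measure R).
Local Notation ReF := (fun f z => complex.Re (f z)).
Local Notation ImF := (fun f z => complex.Im (f z)).
Implicit Types (u v : R * R -> R[i]) (phi : R * R -> R).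
Local Open Scope complex_scope.

Let mH := @measurable_halfplane R.

Lemma weakDP a b u : has_weakD a b u -> is_weak_derivative a b u (weakD a b u).
Proof. by move=> [v uv]; apply: xgetPex; exists v. Qed.

Lemma sqint_weakD a b u : has_weakD a b u ->
  sqintH (ReF (weakD a b u)) /\ sqintH (ImF (weakD a b u)).
Proof. by move=> /weakDP[+ _] => /(L2_sqint mH). Qed.

Lemma ReMr (z : R[i]) (c : R) : complex.Re (z * c%:C) = complex.Re z * c.
Proof. by case: z => x y /=; rewrite mulr0 subr0. Qed.

Lemma ImMr (z : R[i]) (c : R) : complex.Im (z * c%:C) = complex.Im z * c.
Proof. by case: z => x y /=; rewrite mulr0 add0r. Qed.

Lemma sign_complexM n (x y : R) :
  (-1) ^+ n * (x +i* y) = ((-1) ^+ n * x) +i* ((-1) ^+ n * y).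
Proof.
elim: n => [|n IHn]; first by rewrite !expr0 !mul1r.
by rewrite !exprS -!mulrA IHn !mulN1r.
Qed.

(** Splits the complex identity into real ones; since the derivative is in x only, [weak_plane_test]
    then admits test functions that do not vanish at y = 0. *)
Lemma weakD_plane_test a u : L2 area H u -> has_weakD a 0 u ->
  (forall phi, plane_test phi ->
    ipH (ReF u) (iter a dx phi) = (-1) ^+ a * ipH (ReF (weakD a 0 u)) phi) /\
  (forall phi, plane_test phi ->
    ipH (ImF u) (iter a dx phi) = (-1) ^+ a * ipH (ImF (weakD a 0 u)) phi).
Proof.
move=> /(L2_sqint mH)[sRe sIm] hD; have [sRe' sIm'] := sqint_weakD hD.
have [_ Hphi] := weakDP hD.
have Hc phi : test_function H phi ->
    ipH (ReF u) (iter a dx phi) = (-1) ^+ a * ipH (ReF (weakD a 0 u)) phi /\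
    ipH (ImF u) (iter a dx phi) = (-1) ^+ a * ipH (ImF (weakD a 0 u)) phi.
  have RI f (psi : R * R -> R) :
      \int[area]_(z in H) complex.Re (f z * (psi z)%:C) = ipH (ReF f) psi.
    by apply: eq_Rintegral => z _; rewrite ReMr.
  have II f (psi : R * R -> R) :
      \int[area]_(z in H) complex.Im (f z * (psi z)%:C) = ipH (ImF f) psi.
    by apply: eq_Rintegral => z _; rewrite ImMr.
  by move=> /Hphi; rewrite addn0 /cintegral sign_complexM !RI !II => -[-> ->].
by split; apply: weak_plane_test => // phi /Hc[].
Qed.

Lemma ctest_L2 (f : R * R -> R[i]) : ctest_function setT f ->
  [/\ plane_test (ReF f), plane_test (ImF f), L2 area H f,
      L2 area H (cdx f) & L2 area H (cdy f)].
Proof.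
move=> [/test_plane_test tRe /test_plane_test tIm]; split => //.
- by apply: (sqint_L2 mH); exact: plane_test_sqint.
- by apply: (sqint_L2 mH); apply: plane_test_sqint => //; exact: plane_test_dx.
- by apply: (sqint_L2 mH); apply: plane_test_sqint => //; exact: plane_test_dy.
Qed.

Definition dx_approx (v p : plane -> R) :=
  exists an : nat -> R * R -> R, [/\ forall n, plane_test (an n), L2cvgH an v &
    L2cvgH (fun n => dx (an n)) p].

(** The sequence witnessing the trace converges together with its first derivatives, so it also
    provides the smooth approximations of u in H^1. *)
Lemma is_trace_approx u g : H1 u -> is_trace u g ->
  [/\ trace_approx (ReF u) (ReF (weakD 0 1 u)) (ReF g),
      trace_approx (ImF u) (ImF (weakD 0 1 u)) (ImF g),
      dx_approx (ReF u) (ReF (weakD 1 0 u)) &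
      dx_approx (ImF u) (ImF (weakD 1 0 u))].
Proof.
move=> [L2u /weakDP[L2x _] /weakDP[L2y _]] [L2g [f [tf c0 cx cy ct]]].
have F n := ctest_L2 (tf n).
have Lf n : L2 area H (f n) by have [] := F n.
have Lfx n : L2 area H (cdx (f n)) by have [] := F n.
have Lfy n : L2 area H (cdy (f n)) by have [] := F n.
have Lft n : L2 leb setT (fun x => f n (x, 0)).
  by have [tR tI _ _ _] := F n; 
  exact: (sqint_L2 measurableT (plane_test_sqint_line tR) (plane_test_sqint_line tI)).
have [R0 I0] := L2norm_cvg mH Lf L2u c0.
have [Rx Ix] := L2norm_cvg mH Lfx L2x cx.
have [Ry Iy] := L2norm_cvg mH Lfy L2y cy.
have [Rt It] := L2norm_cvg measurableT Lft L2g ct.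
split.
- exists (fun n => ReF (f n)).
  by split; [move=> n; have [] := F n|exact: R0|exact: Ry|exact: Rt].
- exists (fun n => ImF (f n)).
  by split; [move=> n; have [] := F n|exact: I0|exact: Iy|exact: It].
- exists (fun n => ReF (f n)).
  by split; [move=> n; have [] := F n|exact: R0|exact: Rx].
- exists (fun n => ImF (f n)).
  by split; [move=> n; have [] := F n|exact: I0|exact: Ix].
Qed.

(** For the approximations a_n of [v], <w, a_n> = <v, dx (dx a_n)> = - <p, dx a_n>; passing to the
    limit involves only a_n and its first derivative. *)
Lemma ip_dxx (v p w : plane -> R) : sqintH v -> sqintH p -> sqintH w ->
  (forall phi, plane_test phi -> ipH v (dx phi) = - ipH p phi) ->
  (forall phi, plane_test phi -> ipH v (dx (dx phi)) = ipH w phi) ->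
  dx_approx v p -> ipH w v = - ipH p p.
Proof.
move=> sv sp sw vp vw [an [ta ca cda]].
have c1 := ip_cvg mH (L2cvg_cst mH sw) ca.
have c2 : ipH w (an n) @[n --> \oo] --> - ipH p p.
  have E n : ipH w (an n) = - ipH p (dx (an n)).
    by rewrite -vw// vp//; exact: plane_test_dx.
  by rewrite (funext E); apply: cvgN; exact: (ip_cvg mH (L2cvg_cst mH sp) cda).
exact: (cvg_unique _ c1 c2).
Qed.

(** Each real or imaginary part of a component of T u has this form, [s] being the sign produced by
    multiplication by i or -i. *)
Lemma ip_comb_sqr (s delta : R) (A B C : plane -> R) :
  sqintH A -> sqintH B -> sqintH C ->
  let F := fun z => s * A z - B z + delta * C z in
  sqintH F /\
  ipH F F = s ^+ 2 * ipH A A + ipH B B + delta ^+ 2 * ipH C C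
    - 2 * s * ipH A B + 2 * s * delta * ipH A C - 2 * delta * ipH B C.
Proof.
move=> sA sB sC F.
have sA' := sqintZ mH s sA; have sC' := sqintZ mH delta sC.
have sAB := sqintB mH sA' sB; have sF : sqintH F := sqintD mH sAB sC'.
split => //; rewrite /F.
rewrite (ipDl mH sAB sC' sF) (ipBl mH sA' sB sF).
rewrite (ipZl mH s sA sF) (ipZl mH delta sC sF).
rewrite !(ipDr mH sAB sC')// !(ipBr mH sA' sB)//.
rewrite !(ipZr mH s sA)// !(ipZr mH delta sC)//.
by rewrite (ipC _ _ B A) (ipC _ _ C A) (ipC _ _ C B); ring.
Qed.

(** The letters x, y stand for first derivatives and w for the second x-derivative. The products of
    y with w cancel by the first cross identity, those of y with u by the second, and -2 delta <w,
    u> becomes 2 delta ||x||^2. *)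
Lemma energy_identity (delta : R) (u1R u1I u2R u2I x1R x1I x2R x2I
    y1R y1I y2R y2I w1R w1I w2R w2I : plane -> R) :
  sqintH u1R -> sqintH u1I -> sqintH u2R -> sqintH u2I ->
  sqintH y1R -> sqintH y1I -> sqintH y2R -> sqintH y2I ->
  sqintH w1R -> sqintH w1I -> sqintH w2R -> sqintH w2I ->
  ipH w1R u1R = - ipH x1R x1R -> ipH w1I u1I = - ipH x1I x1I ->
  ipH w2R u2R = - ipH x2R x2R -> ipH w2I u2I = - ipH x2I x2I ->
  ipH y1I w2R + ipH y2R w1I = ipH y1R w2I + ipH y2I w1R ->
  ipH y1I u2R + ipH y2R u1I = ipH y1R u2I + ipH y2I u1R ->
  let U1R := fun z => 1 * y1I z - w2R z + delta * u2R z in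
  let U1I := fun z => - 1 * y1R z - w2I z + delta * u2I z in
  let U2R := fun z => - 1 * y2I z - w1R z + delta * u1R z in
  let U2I := fun z => 1 * y2R z - w1I z + delta * u1I z in
  [/\ sqintH U1R, sqintH U1I, sqintH U2R, sqintH U2I &
  ipH U1R U1R + ipH U1I U1I + (ipH U2R U2R + ipH U2I U2I) =
  ipH y1R y1R + ipH y1I y1I + (ipH y2R y2R + ipH y2I y2I) +
  (ipH w1R w1R + ipH w1I w1I + (ipH w2R w2R + ipH w2I w2I)) +
  2 * delta * (ipH x1R x1R + ipH x1I x1I + (ipH x2R x2R + ipH x2I x2I)) +
  delta ^+ 2 * (ipH u1R u1R + ipH u1I u1I + (ipH u2R u2R + ipH u2I u2I))].
Proof.
move=> su1R su1I su2R su2I sy1R sy1I sy2R sy2I sw1R sw1I sw2R sw2I.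
move=> C1R C1I C2R C2I Cxx Cu U1R U1I U2R U2I.
have [sU1R E1R] := ip_comb_sqr 1 delta sy1I sw2R su2R.
have [sU1I E1I] := ip_comb_sqr (-1) delta sy1R sw2I su2I.
have [sU2R E2R] := ip_comb_sqr (-1) delta sy2I sw1R su1R.
have [sU2I E2I] := ip_comb_sqr 1 delta sy2R sw1I su1I.
split => //; rewrite E1R E1I E2R E2I C1R C1I C2R C2I.
have -> : ipH y1I w2R = ipH y1R w2I + ipH y2I w1R - ipH y2R w1I.
  by rewrite -Cxx addrK.
have -> : ipH y1I u2R = ipH y1R u2I + ipH y2I u1R - ipH y2R u1I.
  by rewrite -Cu addrK.
by ring.
Qed.

Lemma L2norm_sqr (f : R * R -> R[i]) : sqintH (ReF f) -> sqintH (ImF f) ->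
  (L2norm area H f ^+ 2 =
    (ipH (ReF f) (ReF f) + ipH (ImF f) (ImF f))%:E)%E.
Proof.
move=> sR sI; rewrite L2normE// -EFin_expe sqr_sqrtr//.
by rewrite addr_ge0 ?ip_ge0.
Qed.

Lemma sqnormE (U : spinor R) :
  sqintH (ReF U.1) -> sqintH (ImF U.1) -> sqintH (ReF U.2) -> sqintH (ImF U.2) ->
  sqnorm U = (ipH (ReF U.1) (ReF U.1) + ipH (ImF U.1) (ImF U.1) +
    (ipH (ReF U.2) (ReF U.2) + ipH (ImF U.2) (ImF U.2)))%:E.
Proof. by move=> *; rewrite /sqnorm !L2norm_sqr. Qed.

End DomainFacts.

Theorem theorem1 (R : realType) (delta : R) (hdelta : 0 <= delta)
    (u : spinor R) (hu : domT u) :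
  (sqnorm (semiDirac delta u) =
   sqnorm (vweakD 0 1 u) + sqnorm (vweakD 2 0 u)
   + (2 * delta)%:E * sqnorm (vweakD 1 0 u) + (delta ^+ 2)%:E * sqnorm u)%E.
Proof.
case: hu => [[h1 h2] [h1xx h2xx] [g [tr1 tr2]]].
have mH := @measurable_halfplane R.
have [L1 h1x h1y] := h1; have [L2u h2x h2y] := h2.
have [T1R T1I X1R X1I] := is_trace_approx h1 tr1.
have [T2R T2I X2R X2I] := is_trace_approx h2 tr2.
have [s1R s1I] := L2_sqint mH L1; have [s2R s2I] := L2_sqint mH L2u.
have [s1xR s1xI] := sqint_weakD h1x; have [s2xR s2xI] := sqint_weakD h2x.
have [s1yR s1yI] := sqint_weakD h1y; have [s2yR s2yI] := sqint_weakD h2y.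
have [s1xxR s1xxI] := sqint_weakD h1xx; have [s2xxR s2xxI] := sqint_weakD h2xx.
have dx1 (v w : R * R -> R) : (forall phi, plane_test phi ->
      ip area halfplane v (iter 1 dx phi) = (-1) ^+ 1 * ip area halfplane w phi) ->
    forall phi, plane_test phi ->
      ip area halfplane v (dx phi) = - ip area halfplane w phi.
  by move=> E phi /E; rewrite expr1 mulN1r.
have dx2 (v w : R * R -> R) : (forall phi, plane_test phi ->
      ip area halfplane v (iter 2 dx phi) = (-1) ^+ 2 * ip area halfplane w phi) ->
    forall phi, plane_test phi ->
      ip area halfplane v (dx (dx phi)) = ip area halfplane w phi.
  by move=> E phi /E; rewrite sqrrN expr1n mul1r.
have [/dx1 W1xR /dx1 W1xI] := weakD_plane_test L1 h1x.
have [/dx1 W2xR /dx1 W2xI] := weakD_plane_test L2u h2x.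
have [/dx2 W1R /dx2 W1I] := weakD_plane_test L1 h1xx.
have [/dx2 W2R /dx2 W2I] := weakD_plane_test L2u h2xx.
have C1R := ip_dxx s1R s1xR s1xxR W1xR W1R X1R.
have C1I := ip_dxx s1I s1xI s1xxI W1xI W1I X1I.
have C2R := ip_dxx s2R s2xR s2xxR W2xR W2R X2R.
have C2I := ip_dxx s2I s2xI s2xxI W2xI W2I X2I.
(* In each pair one function has trace Im g and the other Re g, because u1 and u2 share the trace
   g. *)
have Cxx := cross_term_order2 s1I s2R s1xxI s2xxR s1R s2I s1xxR s2xxI
  W1I W2R W1R W2I T1I T2R T1R T2I.
have Cu := cross_term_order0 T1I T2R T1R T2I.
have := energy_identity delta s1R s1I s2R s2I s1yR s1yI s2yR s2yI
  s1xxR s1xxI s2xxR s2xxI C1R C1I C2R C2I Cxx Cu.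
have R1 z : complex.Re ((semiDirac delta u).1 z) = 1 * complex.Im (weakD 0 1 u.1 z)
    - complex.Re (weakD 2 0 u.2 z) + delta * complex.Re (u.2 z).
  rewrite /semiDirac/=; case: (weakD 0 1 u.1 z) => a b.
  by case: (weakD 2 0 u.2 z) => c d; case: (u.2 z) => e f /=; ring.
have I1 z : complex.Im ((semiDirac delta u).1 z) = - 1 * complex.Re (weakD 0 1 u.1 z)
    - complex.Im (weakD 2 0 u.2 z) + delta * complex.Im (u.2 z).
  rewrite /semiDirac/=; case: (weakD 0 1 u.1 z) => a b.
  by case: (weakD 2 0 u.2 z) => c d; case: (u.2 z) => e f /=; ring.
have R2 z : complex.Re ((semiDirac delta u).2 z) = - 1 * complex.Im (weakD 0 1 u.2 z)
    - complex.Re (weakD 2 0 u.1 z) + delta * complex.Re (u.1 z).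
  rewrite /semiDirac/=; case: (weakD 0 1 u.2 z) => a b.
  by case: (weakD 2 0 u.1 z) => c d; case: (u.1 z) => e f /=; ring.
have I2 z : complex.Im ((semiDirac delta u).2 z) = 1 * complex.Re (weakD 0 1 u.2 z)
    - complex.Im (weakD 2 0 u.1 z) + delta * complex.Im (u.1 z).
  rewrite /semiDirac/=; case: (weakD 0 1 u.2 z) => a b.
  by case: (weakD 2 0 u.1 z) => c d; case: (u.1 z) => e f /=; ring.
(* From here on T u is an abstract pair, known only through its four real components. *)
move: (semiDirac delta u) R1 I1 R2 I2 => U R1 I1 R2 I2.
have {}R1 := funext R1; have {}I1 := funext I1.
have {}R2 := funext R2; have {}I2 := funext I2.
(* All five squared norms are finite, so the extended real identity reduces to the real one. *)
have sumE (k1 k2 a b c d e : R) (A B C D E : \bar R) :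
    A = a%:E -> B = b%:E -> C = c%:E -> D = d%:E -> E = e%:E ->
    a = b + c + k1 * d + k2 * e -> (A = B + C + k1%:E * D + k2%:E * E)%E.
  by move=> -> -> -> -> -> ->.
rewrite -R1 -I1 -R2 -I2 => -[sU1R sU1I sU2R sU2I EU].
exact: (sumE _ _ _ _ _ _ _ _ _ _ _ _ (sqnormE (U := U) sU1R sU1I sU2R sU2I)
  (sqnormE (U := vweakD 0 1 u) s1yR s1yI s2yR s2yI)
  (sqnormE (U := vweakD 2 0 u) s1xxR s1xxI s2xxR s2xxI)
  (sqnormE (U := vweakD 1 0 u) s1xR s1xI s2xR s2xI)
  (sqnormE (U := u) s1R s1I s2R s2I) EU).
Qed.
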